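(* There is a set $\mathcal{A}$ of $17$ points in general position in $\mathbb{R}^6$ whose graph of triangulations (graph of flips) is not connected.
   Context: A finite point set $\mathcal{A}\subset\mathbb{R}^d$ is in general position if no $d+1$ of its points lie in an affine hyperplane; equivalently, none of the $\binom{|\mathcal{A}|}{d+1}$ determinants of $d+1$ (homogenized) points of $\mathcal{A}$ vanish. Let $\mathcal{A}\subset\mathbb{R}^d$ be a finite set affinely spanning $\mathbb{R}^d$. A triangulation of $\mathcal{A}$ is a collection $T$ of affinely spanning and affinely independent subsets of $\mathcal{A}$ (called cells) such that (1) for $\sigma,\sigma'\in T$, $\operatorname{conv}(\sigma)\cap\operatorname{conv}(\sigma')$ is a (possibly empty) face of both $\operatorname{conv}(\sigma)$ and $\operatorname{conv}(\sigma')$; (2) $\bigcup_{\sigma\in T}\operatorname{conv}(\sigma)=\operatorname{conv}(\mathcal{A})$. Not all points of $\mathcal{A}$ need be used. A circuit of $\mathcal{A}$ is a minimal affinely dependent subset $C=\{c_1,\dots,c_k\}$. It has a unique (up to a scalar) affine dependence $\sum\lambda_i c_i=0$, $\sum\lambda_i=0$, with all $\lambda_i\neq 0$; put $C_+=\{c_i:\lambda_i>0\}$, $C_-=\{c_i:\lambda_i<0\}$ (the names $C_+$, $C_-$ may be interchanged). Its two triangulations are $T^C_\pm=\{C\setminus\{c_i\}: c_i\in C_\pm\}$. The link of $\tau\subseteq\mathcal{A}$ in $T$ is $\operatorname{link}_T(\tau)=\{\rho\subseteq\mathcal{A}:\rho\cap\tau=\emptyset,\ \rho\cup\tau\in T\}$.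 Suppose that every $\tau\in T^C_+$ is contained in a cell of $T_1$ and all $\tau\in T^C_+$ have the same link $L$ in the triangulation $T_1$. Then $$T_2=\bigl(T_1\setminus\{\rho\cup\tau:\rho\in L,\tau\in T^C_+\}\bigr)\cup\{\rho\cup\tau:\rho\in L,\tau\in T^C_-\}$$ is a triangulation of $\mathcal{A}$, said to be obtained from $T_1$ by a (geometric bistellar) flip supported on $C$. The graph of triangulations (graph of flips) of $\mathcal{A}$ has as vertices all triangulations of $\mathcal{A}$ and as edges the pairs of triangulations related by a flip. *)

(* Defs.v *)
(* The field of real numbers is an arbitrary [realType]. *)
From mathcomp Require Import all_boot all_order all_algebra.
From mathcomp Require Import boolp classical_sets reals.

Set Implicit Arguments.
Unset Strict Implicit.
Unset Printing Implicit Defensive.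

Import Order.TTheory GRing.Theory Num.Theory.

Local Open Scope ring_scope.

(* A set of [n] points of R^d is given by an injective [p : 'I_n -> 'rV[R]_d],
   and its subsets by the subsets of the index set ['I_n]: cells, circuits and
   links have type [{set 'I_n}], and triangulations [{set {set 'I_n}}].
   Injectivity of [p] is not built into the definitions below. *)

Definition in_hyperplane (R : realType) (d n : nat) (p : 'I_n -> 'rV[R]_d)
    (S : {set 'I_n}) : Prop :=
  exists (a : 'cV[R]_d) (b : R),
    a != 0 /\ forall i, i \in S -> (p i *m a) 0 0 = b.

Definition general_position (R : realType) (d n : nat)
    (p : 'I_n -> 'rV[R]_d) : Prop :=
  forall S : {set 'I_n}, #|S| = d.+1 -> ~ in_hyperplane p S.

(* Only the values of [lam] on [S] matter. *)
Definition affine_dependence (R : realType) (d n : nat)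
    (p : 'I_n -> 'rV[R]_d) (S : {set 'I_n}) (lam : 'I_n -> R) : Prop :=
  \sum_(i in S) lam i *: p i = 0 /\ \sum_(i in S) lam i = 0.

Definition affinely_independent (R : realType) (d n : nat)
    (p : 'I_n -> 'rV[R]_d) (S : {set 'I_n}) : Prop :=
  forall lam : 'I_n -> R,
    affine_dependence p S lam -> forall i, i \in S -> lam i = 0.

Definition affinely_spanning (R : realType) (d n : nat)
    (p : 'I_n -> 'rV[R]_d) (S : {set 'I_n}) : Prop :=
  forall x : 'rV[R]_d, exists lam : 'I_n -> R,
    \sum_(i in S) lam i = 1 /\ \sum_(i in S) lam i *: p i = x.

Definition conv_hull (R : realType) (d n : nat) (p : 'I_n -> 'rV[R]_d)
    (S : {set 'I_n}) : set 'rV[R]_d :=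
  [set x | exists lam : 'I_n -> R,
     [/\ forall i, i \in S -> 0 <= lam i,
         \sum_(i in S) lam i = 1 &
         \sum_(i in S) lam i *: p i = x]]%classic.

(* [F] is cut out of [K] by a linear inequality valid on [K]. The functional
   [a] may be 0, so that the empty set ([b = 1]) and [K] itself ([b = 0])
   are faces. *)
Definition is_face (R : realType) (d : nat) (F K : set 'rV[R]_d) : Prop :=
  exists (a : 'cV[R]_d) (b : R),
    (forall x, K x -> (x *m a) 0 0 <= b) /\
    F = (K `&` [set x | (x *m a) 0 0 = b])%classic.

Definition is_triangulation (R : realType) (d n : nat)
    (p : 'I_n -> 'rV[R]_d) (T : {set {set 'I_n}}) : Prop :=
  [/\ forall s, s \in T -> affinely_spanning p s /\ affinely_independent p s,
      forall s s', s \in T -> s' \in T ->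
        is_face (conv_hull p s `&` conv_hull p s')%classic (conv_hull p s) /\
        is_face (conv_hull p s `&` conv_hull p s')%classic (conv_hull p s') &
      (\bigcup_(s in [set` T]) conv_hull p s)%classic =
        conv_hull p [set: 'I_n]%SET].

Definition is_circuit (R : realType) (d n : nat) (p : 'I_n -> 'rV[R]_d)
    (C : {set 'I_n}) : Prop :=
  ~ affinely_independent p C /\
  forall D : {set 'I_n}, D \proper C -> affinely_independent p D.

Definition link (n : nat) (T : {set {set 'I_n}}) (t : {set 'I_n}) :
    {set {set 'I_n}} :=
  [set r : {set 'I_n} | [disjoint r & t] && (r :|: t \in T)]%SET.

(* [pos_part C lam] is C_+ and [neg_part C lam] is C_-, when [lam] is an affine
   dependence on [C]. *)
Definition pos_part (R : realType) (n : nat) (C : {set 'I_n})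
    (lam : 'I_n -> R) : {set 'I_n} :=
  [set i in C | 0 < lam i]%SET.

Definition neg_part (R : realType) (n : nat) (C : {set 'I_n})
    (lam : 'I_n -> R) : {set 'I_n} :=
  [set i in C | lam i < 0]%SET.

(* For [D] equal to C_+ or C_-, the triangulation T^C_+ or T^C_- of [C]. *)
Definition circuit_triangulation (n : nat) (C D : {set 'I_n}) :
    {set {set 'I_n}} :=
  [set C :\ i | i in D]%SET.

Definition star_join (n : nat) (L K : {set {set 'I_n}}) : {set {set 'I_n}} :=
  [set r :|: t | r in L, t in K]%SET.

(* Both labellings of C_+ and C_- are covered, since [lam] may be replaced by
   its opposite. *)
Definition is_flip (R : realType) (d n : nat) (p : 'I_n -> 'rV[R]_d)
    (T1 T2 : {set {set 'I_n}}) : Prop :=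
  exists (C : {set 'I_n}) (lam : 'I_n -> R) (L : {set {set 'I_n}}),
    let Tpos := circuit_triangulation C (pos_part C lam) in
    let Tneg := circuit_triangulation C (neg_part C lam) in
    [/\ is_circuit p C,
        affine_dependence p C lam /\ (forall i, i \in C -> lam i != 0),
        forall t, t \in Tpos -> exists2 s, s \in T1 & t \subset s,
        forall t, t \in Tpos -> link T1 t = L &
        T2 = (T1 :\: star_join L Tpos) :|: star_join L Tneg].

Definition flip_edge (R : realType) (d n : nat) (p : 'I_n -> 'rV[R]_d) :
    rel {set {set 'I_n}} :=
  fun T1 T2 => `[< [/\ is_triangulation p T1, is_triangulation p T2 &
                       is_flip p T1 T2 \/ is_flip p T2 T1] >].

Definition flip_graph_connected (R : realType) (d n : nat)
    (p : 'I_n -> 'rV[R]_d) : Prop :=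
  forall T1 T2 : {set {set 'I_n}},
    is_triangulation p T1 -> is_triangulation p T2 ->
    connect (flip_edge p) T1 T2.

(* Main.v *)
From Stdlib Require Import ZArith.
Require Import Defs.
From mathcomp Require Import all_boot all_order all_algebra.
From mathcomp Require Import boolp classical_sets reals.
From mathcomp Require Import fintype finset.
From mathcomp Require Import ring lra zify.
From mathcomp Require Import ssrZ.

Set Implicit Arguments.
Unset Strict Implicit.
Unset Printing Implicit Defensive.

Import Order.TTheory GRing.Theory Num.Theory.
Local Open Scope ring_scope.

(** Take the cross-polytope of R^4, with vertices v = a_0, .., a_3, b_0, .., b_3
    where a_i and a_(i+2), and likewise b_j and b_(j+2), are opposite, and
    choose eight pairwise nonparallel vectors x_v of the plane. The 17 points
    are small perturbations of the origin O and of the points (v, x_v) and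
    (v, - x_v) of R^4 x R^2.

    Over a facet {a_i, a_(i+1), b_j, b_(j+1)} of the cross-polytope lie eight of
    the points. By the Cayley trick, the triangulations of these eight points
    correspond to the tilings by rhombi of the octagon which is the sum of the
    four segments [- x_v, x_v]; the six rhombi of a tiling give six cells once
    O is joined to them. The restriction to a triangle of the cross-polytope is
    a tiled hexagon, for which there are two choices, so a coherent family of 16
    octagon tilings is a choice of 32 signs, constrained facet by facet.
    An octagon tiling admits exactly two hexagon flips. There are twice 16 of
    these in total and 32 triangles, and the signs can be chosen such that each
    triangle is flippable in exactly one of the two facets that contain it.
    No hexagon can then be flipped: the flip would have to take place in both
    facets at once. In general position the circuit of the flip has an
    eighth point, which lies over only one of the two facets, and the
    perturbation is chosen such that this does not make the flip possible.

    What survives all flips is the core, made of the cells of four of the six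
    rhombi of each octagon. The reason is local ([frozen], [flip_keeps_frozen]):
    a flip that removes a cell s and brings in a point q must also remove the
    cells obtained by exchanging q with any vertex of s that has the same sign as
    q in the circuit; for one such vertex c, a cell of the core already lies
    behind the facet s minus c, and its apex is not q. Hence
    ([frozen_disconnected]) it is enough to exhibit two triangulations, only one
    of which contains the core.

    The first one consists of the 96 cells of the octagon tilings, of the cones
    with apex O over the facets of the convex hull that do not come from facets of
    the cross-polytope, and of 28 cells without O which fill the gap between the
    tilings and the perturbed boundary of the convex hull. The second one is the
    cone with apex O over the boundary of the convex hull. That these
    are triangulations follows from [triangulation_criterion]: each facet of a
    cell is either in the boundary of the convex hull or shared with a cell on
    the other side, and no circuit crosses two cells. All this depends only on
    the signs of the maximal minors of the matrix of homogeneous coordinates,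
    which are computed by exterior multiplication of its rows. *)

(** * Minors and cofactors by exterior multiplication *)

Section Exterior.
Variable K : comNzRingType.
Implicit Types (w m : seq K) (g h : seq bool -> K) (bs : seq bool).

(** A function [g] on bit strings of length n is read as an element of the
    exterior algebra on n generators, [g bs] being its coefficient on the product
    of the generators selected by [bs]. This is left multiplication by the linear
    form [w], one generator at a time. *)
Fixpoint wedge w g bs : K :=
  match w, bs with
  | a :: w', b :: bs' =>
      if b then a * g (false :: bs') - wedge w' (fun x => g (true :: x)) bs'
      else wedge w' (fun x => g (false :: x)) bs'
  | _, _ => 0
  end.

Definition unit_form bs : K := (~~ has id bs)%:R.

Definition minors (rows : seq (seq K)) : seq bool -> K :=
  foldr wedge unit_form rows.

(** Interior product with the vector [m]. *)
Fixpoint contract m g bs : K :=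
  match m, bs with
  | c :: m', b :: bs' =>
      if b then - contract m' (fun x => g (true :: x)) bs'
      else c * g (true :: bs') + contract m' (fun x => g (false :: x)) bs'
  | _, _ => 0
  end.

(** The coefficients of the terms of [w] in [wedge w g bs]: see [wedgeE]. *)
Fixpoint cofactors g bs : seq K :=
  if bs is b :: bs' then
    if b then g (false :: bs') ::
              [seq - x | x <- cofactors (fun x => g (true :: x)) bs']
    else 0 :: cofactors (fun x => g (false :: x)) bs'
  else [::].

Lemma eq_wedge w g h bs : (forall x, size x = size bs -> g x = h x) ->
  wedge w g bs = wedge w h bs.
Proof.
elim: w g h bs => [|a w IH] g h [|b bs] //= gh.
by case: b; rewrite ?gh //; [congr (_ - _)|]; apply: IH => x sx; apply: gh; rewrite /= sx.
Qed.

Lemma wedge0 w bs : wedge w (fun=> 0) bs = 0.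
Proof.
by elim: w bs => [|a w IH] [|b bs] //=; rewrite !IH mulr0 subr0 if_same.
Qed.

Lemma wedge_lin w a b g h bs :
  wedge w (fun x => a * g x + b * h x) bs = a * wedge w g bs + b * wedge w h bs.
Proof.
elim: w g h bs => [|c w IH] g h [|d bs] /=; try by rewrite !mulr0 addr0.
by case: d; rewrite IH //; ring.
Qed.

Lemma contract_lin m a b g h bs :
  contract m (fun x => a * g x + b * h x) bs
  = a * contract m g bs + b * contract m h bs.
Proof.
elim: m g h bs => [|c w IH] g h [|d bs] /=; try by rewrite !mulr0 addr0.
by case: d; rewrite IH //; ring.
Qed.

Lemma eq_contract m g h bs : g =1 h -> contract m g bs = contract m h bs.
Proof.
elim: m g h bs => [|a w IH] g h [|b bs] //= gh.
by case: b; rewrite ?gh; [congr (- _)|congr (_ + _)]; apply: IH => x; apply: gh.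
Qed.

Lemma wedgeC u v g bs : wedge u (wedge v g) bs = - wedge v (wedge u g) bs.
Proof.
elim: u v g bs => [|a u IH] [|b v] g [|c bs] /=; rewrite ?oppr0 //.
- by rewrite wedge0 subr0 mulr0 if_same oppr0.
- by rewrite wedge0 subr0 mulr0 if_same.
case: c; last exact: IH.
have E x y w1 w2 : wedge w1 (fun z => x * g (false :: z)
    - wedge w2 (fun t => g (true :: t)) z) y
  = x * wedge w1 (fun z => g (false :: z)) y
    - wedge w1 (wedge w2 (fun t => g (true :: t))) y.
  rewrite -[in RHS]mulN1r -wedge_lin; apply: eq_wedge => z _.
  by rewrite mulN1r.
rewrite !E IH.
by move: (wedge v _ bs) (wedge v _ bs) (wedge u _ bs) => P Q S; ring.
Qed.

Lemma wedge_sq w g bs : wedge w (wedge w g) bs = 0.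
Proof.
elim: w g bs => [|a w IH] g [|c bs] //=.
case: c; last exact: IH.
rewrite [X in _ - X](_ : _ = a * wedge w (fun z => g (false :: z)) bs
    + (-1) * wedge w (wedge w (fun t => g (true :: t))) bs).
  by rewrite IH; ring.
by rewrite -wedge_lin; apply: eq_wedge => z _; rewrite mulN1r.
Qed.

(** A determinant with a repeated row vanishes. Expanded along that row, this
    is the linear relation between the columns of a matrix given by its minors. *)
Lemma wedge_minors w rows bs : w \in rows -> wedge w (minors rows) bs = 0.
Proof.
elim: rows bs => [//|v rows IH] bs; rewrite inE => /predU1P[->|wr] /=.
  exact: wedge_sq.
rewrite wedgeC (@eq_wedge _ _ (fun=> 0)) ?wedge0 ?oppr0 // => x _.
exact: IH.
Qed.

Lemma size_cofactors g bs : size (cofactors g bs) = size bs.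
Proof. by elim: bs g => //= -[] bs IH g /=; rewrite ?size_map IH. Qed.

Lemma wedgeE w g bs : size w = size bs ->
  wedge w g bs = \sum_(i < size bs) w`_i * (cofactors g bs)`_i.
Proof.
elim: w g bs => [|a w IH] g [|b bs] //=; first by rewrite big_ord0.
move=> [sz]; rewrite big_ord_recl /=; case: b => /=.
  rewrite IH // -sumrN; congr (_ + _); apply: eq_bigr => i _.
  by rewrite add0n (nth_map 0) ?size_cofactors // mulrN.
by rewrite mulr0 add0r IH.
Qed.

Lemma cofactors_out g bs i : nth false bs i = false -> (cofactors g bs)`_i = 0.
Proof.
elim: bs g i => [|b bs IH] g [|i] //= E; first by rewrite E.
case: b => /=; last exact: IH.
case: (ltnP i (size bs)) => ilt; last by rewrite nth_default // size_map size_cofactors.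
by rewrite (nth_map 0) ?size_cofactors // IH ?oppr0.
Qed.

Lemma cofactors_in g bs i : nth false bs i ->
  exists e : bool, (cofactors g bs)`_i = (-1) ^+ e * g (set_nth false bs i false).
Proof.
elim: bs g i => [|b bs IH] g [|i] //= E.
  by rewrite E; exists false; rewrite expr0 mul1r.
case: b => /=; last exact: IH.
have ilt : (i < size bs)%N.
  by case: ltnP => // ?; move: E; rewrite nth_default.
have [e eq_e] := IH (fun x => g (true :: x)) _ E.
by exists (~~ e); rewrite (nth_map 0) ?size_cofactors // eq_e signrN mulNr.
Qed.

Fixpoint dot w m : K :=
  match w, m with a :: w', c :: m' => a * c + dot w' m' | _, _ => 0 end.

Lemma dotE w m n : size w = n -> size m = n ->
  dot w m = \sum_(i < n) w`_i * m`_i.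
Proof.
elim: w m n => [|a w IH] [|c m] [|n] //=; rewrite ?big_ord0 //.
by move=> [sw] [sm]; rewrite big_ord_recl (IH _ n).
Qed.

(** Interior product is an antiderivation. *)
Lemma contract_wedge m w g bs : size m = size bs -> size w = size bs ->
  contract m (wedge w g) bs = dot w m * g bs - wedge w (contract m g) bs.
Proof.
elim: bs m w g => [|b bs IH] [|c m] [|a w] g //=; first by rewrite mul0r subr0.
move=> [sm] [sw]; case: b => /=.
  rewrite (@eq_contract _ _ (fun x => a * g (false :: x)
     + (-1) * wedge w (fun t => g (true :: t)) x)); last by move=> x; rewrite mulN1r.
  rewrite contract_lin IH //.
  rewrite (@eq_wedge _ (fun x => - contract m _ x)
     (fun x => 0 * g x + (-1) * contract m (fun t => g (true :: t)) x)); last first.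
    by move=> x _; rewrite mul0r add0r mulN1r.
  rewrite wedge_lin.
  by move: (contract m _ _) (wedge w _ _) (wedge w _ _) => P Q S; ring.
rewrite IH //.
rewrite [X in _ = _ - X](@eq_wedge _ _ (fun x => c * g (true :: x)
   + 1 * contract m (fun t => g (false :: t)) x)) => [|x _]; last by rewrite mul1r.
rewrite wedge_lin.
by move: (wedge w _ _) (wedge w _ _) => P Q; ring.
Qed.

Lemma contract0 m bs : contract m (fun=> 0) bs = 0.
Proof.
elim: m bs => [|c m IH] [|b bs] //=.
by case: b; rewrite IH ?oppr0 // mulr0 addr0.
Qed.

(** The minors of a matrix satisfy the relations of its kernel: if [m] is a
    relation between the columns, then the interior product with [m] passes
    through all the factors and kills the unit. *)
Lemma contract_minors m rows bs : size m = size bs ->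
  (forall w, w \in rows -> size w = size bs /\ dot w m = 0) ->
  contract m (minors rows) bs = 0.
Proof.
move=> sm; elim: rows bs sm => [|w rows IH] bs sm rowsP /=.
  elim: bs m sm {rowsP} => [|b bs IHbs] [|c m] //= [sm].
  case: b => /=; last by rewrite /unit_form /= mulr0 add0r IHbs.
  rewrite (@eq_contract _ _ (fun=> 0)) ?contract0 ?oppr0 //.
have [sw dw] := rowsP w (mem_head _ _).
rewrite contract_wedge // dw mul0r (@eq_wedge _ _ (fun=> 0)) ?wedge0 ?subr0 //.
move=> x sx; apply: IH => [|v vr]; rewrite sx //.
by apply: rowsP; rewrite inE vr orbT.
Qed.

Lemma contract_out m g bs i : (i < size bs)%N -> size m = size bs ->
  nth false bs i = false ->
  (forall j, j != i -> nth false bs j = false -> m`_j = 0) ->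
  exists e : bool, contract m g bs = (-1) ^+ e * m`_i * g (set_nth false bs i true).
Proof.
elim: bs m g i => [|b bs IH] [|c m] g [|i] //= ilt [sm].
  move=> -> mP; exists false; rewrite expr0 mul1r.
  rewrite [X in _ + X](_ : _ = 0) ?addr0 //.
  have {}mP j : nth false bs j = false -> m`_j = 0 by apply: (mP j.+1).
  elim: bs m sm mP (fun x => g (false :: x)) {IH ilt} => [|b' bs IH] [|a m] //= [sm] mP h.
  case: b' mP => mP.
    by rewrite IH ?oppr0 // => j; apply: (mP j.+1).
  have -> : a = 0 := mP 0%N erefl.
  by rewrite mul0r add0r IH // => j; apply: (mP j.+1).
move=> bsi mP.
have [|e he] := IH m (fun x => g (b :: x)) i ilt sm bsi.
  by move=> j ji; apply: (mP j.+1).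
case: b {IH} mP he => mP he.
  by exists (~~ e); rewrite he signrN !mulNr.
have -> : c = 0 := mP 0%N isT erefl.
by exists e; rewrite he mul0r add0r.
Qed.

Lemma minors_behead rows bs : all (fun w => size w == (size bs).+1) rows ->
  minors rows (false :: bs) = minors (map behead rows) bs.
Proof.
elim: rows bs => [//|[|a w] rows IH] bs //= /andP[sw rowsP].
apply: eq_wedge => x sx; apply: IH.
by rewrite sx.
Qed.

End Exterior.

(** * Affine dependences of a point configuration *)

Section Configuration.
Variables (R : fieldType) (d n : nat) (p : 'I_n -> 'rV[R]_d).
Implicit Types (S C : {set 'I_n}) (m : 'I_n -> R).

Definition bits S : seq bool := [seq i \in S | i <- enum 'I_n].

Lemma size_bits S : size (bits S) = n.
Proof. by rewrite size_map size_enum_ord. Qed.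

Lemma nth_map_enum (T : Type) (x0 : T) (f : 'I_n -> T) (i : 'I_n) :
  nth x0 [seq f j | j <- enum 'I_n] i = f i.
Proof. by rewrite (nth_map i) ?size_enum_ord // nth_ord_enum. Qed.

Lemma set_nth_bits S (i : 'I_n) b :
  set_nth false (bits S) i b = bits (if b then i |: S else S :\ i).
Proof.
apply: (@eq_from_nth _ false) => [|j].
  by rewrite size_set_nth !size_bits; apply/maxn_idPr.
rewrite size_set_nth size_bits (maxn_idPr _) // => jn.
pose k := Ordinal jn; rewrite nth_set_nth /= -[j]/(val k) !nth_map_enum.
have -> : (val k == i :> nat) = (k == i) by [].
by case: b; rewrite !inE; case: eqP.
Qed.

Definition homogeneous_rows : seq (seq R) :=
  nseq n 1 :: [seq [seq p i 0 k | i <- enum 'I_n] | k <- enum 'I_d].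

Definition chirotope S : R := minors homogeneous_rows (bits S).

Definition circuit_dep C (i : 'I_n) : R :=
  (cofactors (minors homogeneous_rows) (bits C))`_i.

Definition dependence m := \sum_(i < n) m i = 0 /\ \sum_(i < n) m i *: p i = 0.

Lemma size_homogeneous_rows w : w \in homogeneous_rows -> size w = n.
Proof.
rewrite inE => /predU1P[->|/mapP[k _ ->]]; first exact: size_nseq.
by rewrite size_map size_enum_ord.
Qed.

(** An affine dependence is a relation between the columns of the matrix of
    homogeneous coordinates. *)
Lemma dependence_rows m :
  dependence m <-> (forall w, w \in homogeneous_rows -> \sum_(i < n) w`_i * m i = 0).
Proof.
split=> [[m1 mp] w|mP].
  rewrite inE => /predU1P[->|/mapP[k _ ->]].
    by rewrite -[RHS]m1; apply: eq_bigr => i _; rewrite nth_nseq ltn_ord mul1r.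
  move/rowP: mp => /(_ k); rewrite summxE [RHS]mxE => mk; rewrite -[RHS]mk.
  by apply: eq_bigr => i _; rewrite nth_map_enum mxE mulrC.
split.
  rewrite -[RHS](mP (nseq n 1)) ?mem_head //.
  by apply: eq_bigr => i _; rewrite nth_nseq ltn_ord mul1r.
apply/rowP => k; rewrite summxE [RHS]mxE.
rewrite -[RHS](mP [seq p i 0 k | i <- enum 'I_n]); last first.
  by rewrite in_cons; apply/orP; right; apply/mapP; exists k; rewrite ?mem_enum.
by apply: eq_bigr => i _; rewrite nth_map_enum mxE mulrC.
Qed.

Lemma circuit_dependence C : dependence (circuit_dep C).
Proof.
apply/dependence_rows => w wr; rewrite -[RHS](wedge_minors (bits C) wr).
rewrite wedgeE; last by rewrite size_bits size_homogeneous_rows.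
by rewrite size_bits.
Qed.

Lemma circuit_dep_out C i : i \notin C -> circuit_dep C i = 0.
Proof. by move=> iC; apply: cofactors_out; rewrite nth_map_enum (negPf iC). Qed.

Lemma circuit_dep_in C i : i \in C ->
  exists e : bool, circuit_dep C i = (-1) ^+ e * chirotope (C :\ i).
Proof.
move=> iC; have [|e eq_e] := @cofactors_in _ (minors homogeneous_rows) (bits C) i.
  by rewrite nth_map_enum.
by exists e; rewrite /circuit_dep eq_e set_nth_bits.
Qed.

(** In the relation of [contract_minors] on [S :\ i], only the term of [i]
    remains if [m] is supported in [S]. *)
Lemma chirotope_indep S m : chirotope S != 0 -> dependence m ->
  (forall i, i \notin S -> m i = 0) -> forall i, m i = 0.
Proof.
move=> S0 /dependence_rows mP mS i; have [iS|/mS//] := boolP (i \in S).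
pose M := [seq m j | j <- enum 'I_n].
have sM : size M = n by rewrite size_map size_enum_ord.
have : contract M (minors homogeneous_rows) (bits (S :\ i)) = 0.
  apply: contract_minors => [|w wr]; rewrite size_bits //; split; first exact: size_homogeneous_rows.
  rewrite (dotE (size_homogeneous_rows wr) sM) -[RHS](mP _ wr).
  by apply: eq_bigr => j _; rewrite nth_map_enum.
have [||||e ->] := @contract_out _ M (minors homogeneous_rows) (bits (S :\ i)) i.
- by rewrite size_bits.
- by rewrite size_bits.
- by rewrite nth_map_enum !inE eqxx.
- move=> j ji; case: (ltnP j n) => [jn|?] E; last by rewrite nth_default ?sM.
  move: E.
  rewrite -[j]/(val (Ordinal jn)) !nth_map_enum !inE => /negbT.
  rewrite negb_and negbK => /orP[/eqP ij|/mS //].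
  by rewrite -ij eqxx in ji.
rewrite set_nth_bits finset.setD1K // nth_map_enum => /eqP.
by rewrite !mulf_eq0 signr_eq0 (negPf S0) orbF /= => /eqP.
Qed.

(** Cramer's rule: [y] is added as a first column, and the repeated row
    argument on [y] and [S] expresses the column of [y] by those of [S]. *)
Lemma chirotope_span S (y : 'rV[R]_d) : chirotope S != 0 ->
  exists m, [/\ forall i, i \notin S -> m i = 0, \sum_i m i = 1
               & \sum_i m i *: p i = y].
Proof.
move=> S0.
pose rows := (1 :: nseq n 1) ::
  [seq y 0 k :: [seq p i 0 k | i <- enum 'I_n] | k <- enum 'I_d].
have behead_rows : map behead rows = homogeneous_rows.
  by rewrite /= -map_comp.
pose g x := minors rows (true :: x).
pose c := cofactors g (bits S).
have key a w : (a :: w) \in rows -> a * chirotope S = \sum_(i < n) w`_i * c`_i.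
  move=> wr; have := wedge_minors (true :: bits S) wr.
  rewrite [LHS](_ : _ = a * minors rows (false :: bits S) - wedge w g (bits S)) //.
  move=> /subr0_eq.
  rewrite minors_behead ?behead_rows => [->|].
    rewrite wedgeE size_bits //; move: wr.
    by rewrite inE => /predU1P[[_ ->]|/mapP[k _ [_ ->]]];
      rewrite ?size_nseq // size_map size_enum_ord.
  rewrite /= size_nseq size_bits eqxx /= all_map; apply/allP => k _ /=.
  by rewrite size_map size_enum_ord.
exists (fun i => c`_i / chirotope S); split.
- by move=> i iS; rewrite cofactors_out ?mul0r // nth_map_enum (negPf iS).
- rewrite -mulr_suml; apply: (canLR (mulfK S0)).
  rewrite (key 1 (nseq n 1)) ?mem_head //.
  by apply: eq_bigr => i _; rewrite nth_nseq ltn_ord mul1r.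
apply/rowP => k; rewrite summxE; apply: (mulIf S0).
rewrite (key (y 0 k) [seq p i 0 k | i <- enum 'I_n]); last first.
  by rewrite in_cons; apply/orP; right; apply/mapP; exists k; rewrite ?mem_enum.
rewrite mulr_suml; apply: eq_bigr => i _.
by rewrite nth_map_enum mxE mulrAC mulfVK // mulrC.
Qed.

End Configuration.

Lemma subset_of_card (T : finType) (A : {set T}) k :
  (k <= #|A|)%N -> exists2 B : {set T}, B \subset A & #|B| = k.
Proof.
move=> kA; exists [set x in take k (enum A)]%SET.
  by apply/subsetP => x; rewrite inE => /mem_take; rewrite mem_enum.
rewrite cardsE (card_uniqP _) ?take_uniq ?enum_uniq //.
by rewrite size_takel // -cardE.
Qed.

Lemma superset_of_card (T : finType) (A : {set T}) k :
  (#|A| <= k <= #|T|)%N -> exists2 B : {set T}, A \subset B & #|B| = k.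
Proof.
move=> /andP[Ak kT].
have [|B BA cB] := @subset_of_card _ (~: A)%SET (#|T| - k).
  by have := cardsC A; lia.
exists (~: B)%SET; first by rewrite -finset.subsetC.
by have := cardsC B; lia.
Qed.

(** * Points in generic position *)

Section GenericPoint.
Variables (R : realType) (V : lmodType R).
Implicit Types (f g : V -> R) (x y z u : V).

Definition affine_fun f :=
  forall x y (t : R), f ((1 - t) *: x + t *: y) = (1 - t) * f x + t * f y.

(** Moving from [a] towards [b] by a small enough step preserves the signs of
    finitely many nonzero quantities. *)
Lemma small_step (I : eqType) (a b : I -> R) (l : seq I) :
  (forall i, i \in l -> a i != 0) ->
  exists2 e, 0 < e < 1 & forall t i, 0 < t <= e -> i \in l ->
    0 < a i * ((1 - t) * a i + t * b i).
Proof.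
elim: l => [|k l IH] a0; first by exists (1 / 2) => //; apply/andP; split; lra.
have [|e e01 eP] := IH; first by move=> i il; apply: a0; rewrite inE il orbT.
have ak0 : 0 < a k ^+ 2 by rewrite exprn_even_gt0 // a0 // mem_head.
pose r := a k ^+ 2 / (2 * (a k ^+ 2 + `|a k * b k|)).
have r0 : 0 < r by rewrite divr_gt0 //; have := normr_ge0 (a k * b k); lra.
exists (Num.min e r); first by rewrite lt_min gt_min; lra.
move=> t i; rewrite le_min inE => /andP[t0 /andP[te tr]] /predU1P[->|il]; last first.
  by apply: eP; rewrite // t0.
have rE : r * (a k ^+ 2 + `|a k * b k|) = a k ^+ 2 / 2.
  by rewrite /r; field; apply/eqP; have := normr_ge0 (a k * b k); lra.
have := ler_norm (- (a k * b k)); rewrite normrN => nab.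
have : t * (a k ^+ 2 + `|a k * b k|) <= a k ^+ 2 / 2.
  by rewrite -rE ler_wpM2r //; have := normr_ge0 (a k * b k); lra.
rewrite !expr2 in ak0 *; nra.
Qed.

Lemma generic_point (I J : eqType) (f : I -> V -> R) (g : J -> V -> R)
    (l : seq I) (k : seq J) z0 :
  (forall i, affine_fun (f i)) -> (forall j, affine_fun (g j)) ->
  (forall i, i \in l -> exists u, f i u != 0) ->
  (forall j, j \in k -> 0 < g j z0) ->
  exists z, (forall i, i \in l -> f i z != 0) /\ (forall j, j \in k -> 0 < g j z).
Proof.
move=> faff gaff fl gk; elim: l fl => [|i l IH] fl; first by exists z0.
have [|z [fz gz]] := IH; first by move=> j jl; apply: fl; rewrite inE jl orbT.
have [fiz|fiz] := eqVneq (f i z) 0; last first.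
  by exists z; split=> // j; rewrite inE => /predU1P[->|/fz].
have [u fu] := fl i (mem_head _ _).
have [e1 e1P h1] := small_step (fun j => f j u) fz.
have [|e2 e2P h2] := @small_step _ (fun j => g j z) (fun j => g j u) k.
  by move=> j /gz; rewrite lt_def => /andP[].
pose t := Num.min e1 e2.
have t1 : 0 < t <= e1 by rewrite /t lt_min ge_min lexx andbT; lra.
have t2 : 0 < t <= e2 by rewrite /t lt_min ge_min lexx orbT andbT; lra.
exists ((1 - t) *: z + t *: u); split=> j.
  rewrite inE faff => /predU1P[->|jl].
    by rewrite fiz mulr0 add0r mulf_neq0 //; case/andP: t1; rewrite lt_def => /andP[].
  by have := h1 t j t1 jl; apply: contraTneq => ->; rewrite mulr0 ltxx.
by move=> jk; rewrite gaff; have := h2 t j t2 jk; rewrite pmulr_rgt0 // gz.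
Qed.
End GenericPoint.
(** * Circuits and barycentric coordinates *)

Section Geometry.
Variables (R : realType) (d n : nat) (p : 'I_n -> 'rV[R]_d).
Implicit Types (s S C : {set 'I_n}) (m : 'I_n -> R) (T : {set {set 'I_n}}).
Implicit Types (x y z : 'rV[R]_d).

Hypothesis generic : forall S, #|S| = d.+1 -> chirotope p S != 0.
Hypothesis ltdn : (d < n)%N.

Lemma generic_indep S m : (#|S| <= d.+1)%N -> dependence p m ->
  (forall i, i \notin S -> m i = 0) -> forall i, m i = 0.
Proof.
move=> cS mdep mS.
have [|S' SS' cS'] := @superset_of_card _ S d.+1; first by rewrite cS card_ord.
apply: (chirotope_indep (generic cS')) => // i iS'.
by apply: mS; apply: contra iS'; apply: (subsetP SS').
Qed.

Lemma circuit_dep_neq0 C i : #|C| = d.+2 -> (circuit_dep p C i != 0) = (i \in C).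
Proof.
move=> cC; have [iC|iC] := boolP (i \in C); last by rewrite circuit_dep_out ?eqxx.
have [e ->] := circuit_dep_in p iC.
by rewrite mulf_neq0 ?signr_eq0 // generic //; move: (cardsD1 i C); rewrite iC cC => -[].
Qed.

(** Subtracting from [m] the largest multiple of a circuit that does not reverse
    any sign of [m] makes a coordinate vanish, which allows induction on the
    support. *)
Lemma conformal_circuit m : dependence p m -> (exists i, m i != 0) ->
  exists C (e : bool), #|C| = d.+2 /\
    forall i, (0 < (-1) ^+ e * circuit_dep p C i -> 0 < m i) /\
              ((-1) ^+ e * circuit_dep p C i < 0 -> m i < 0).
Proof.
move: {2}(#|_|).+1 (ltnSn #|[set i | m i != 0]%SET|) => N.
elim: N m => [//|N IH] m ltN mdep mn0.
pose S := [set i | m i != 0]%SET.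
have cS : (d.+2 <= #|S|)%N.
  rewrite ltnNge; apply/negP => cS; have [i /eqP[]] := mn0.
  by apply: (generic_indep cS mdep) => j; rewrite inE negbK => /eqP.
have [C CS cC] := subset_of_card cS.
have [i0 i0C] : exists i0, i0 \in C by apply/set0Pn; rewrite -card_gt0 cC.
have /subsetP/(_ i0 i0C) := CS; rewrite inE => mi0.
have ci0 : circuit_dep p C i0 != 0 by rewrite circuit_dep_neq0.
pose e := (circuit_dep p C i0 * m i0 < 0)%R.
pose l i := (-1) ^+ e * circuit_dep p C i.
have li0 : 0 < l i0 * m i0.
  rewrite /l -mulrA /e; have := mulf_neq0 ci0 mi0.
  case: (ltrP _ 0) => h xn0; first by rewrite expr1 mulN1r oppr_gt0.
  by rewrite expr0 mul1r lt_def xn0.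
have ldep : dependence p l.
  have [l1 l2] := circuit_dependence p C; split.
    by rewrite -mulr_sumr l1 mulr0.
  rewrite (eq_bigr (fun i => (-1) ^+ e *: (circuit_dep p C i *: p i))).
    by rewrite -scaler_sumr l2 scaler0.
  by move=> i _; rewrite scalerA.
pose t := m i0 / l i0.
case: (@Order.TotalTheory.arg_minP _ _ _ i0 (fun i => 0 < l i * m i) (fun i => m i / l i) li0)
  => i1 li1 tmin.
have lC i : m i = 0 -> l i = 0.
  move=> mi; rewrite /l circuit_dep_out ?mulr0 //; apply/negP => /(subsetP CS).
  by rewrite inE mi eqxx.
set u := m i1 / l i1 in tmin.
have l1n0 : l i1 != 0 by apply/eqP => h; rewrite h mul0r ltxx in li1.
have u0 : 0 < u.
  have -> : u = (l i1 * m i1) / (l i1) ^+ 2 by rewrite /u; field.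
  by rewrite divr_gt0 // exprn_even_gt0.
pose v i := m i - u * l i.
have umin i : 0 < l i * m i -> u * (l i) ^+ 2 <= l i * m i.
  move=> h; have ln0 : l i != 0 by apply/eqP => h'; rewrite h' mul0r ltxx in h.
  have -> : l i * m i = m i / l i * l i ^+ 2 by field.
  by rewrite ler_wpM2r ?sqr_ge0 // tmin.
have vpos i : 0 < v i -> 0 < m i.
  rewrite /v => h; case: (ltrgt0P (m i)) => // [mi|mi]; last first.
    by move: h; rewrite mi (lC i mi); lra.
  by have := umin i; nra.
have vneg i : v i < 0 -> m i < 0.
  rewrite /v => h; case: (ltrgt0P (m i)) => // [mi|mi]; last first.
    by move: h; rewrite mi (lC i mi); lra.
  by have := umin i; nra.
have [/existsP[j vj]|/existsPn v0] := boolP [exists j, v j != 0]; last first.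
  (* no residue is left: m is a positive multiple of the circuit itself *)
  exists C, e; split=> // i; have /negPn/eqP := v0 i.
  rewrite -/(l i) /v => /subr0_eq ->.
  by split=> h; [apply: mulr_gt0 | rewrite pmulr_rlt0].
have [|||C' [e' [cC' h]]] := IH v.
- apply: (@leq_trans #|S|) ltN; apply: proper_card; apply/properP; split.
    apply/subsetP => i; rewrite !inE; apply: contra => /eqP mi.
    by rewrite /v mi (lC i mi) mulr0 subrr.
  exists i1; rewrite !inE; last by rewrite /v /u mulfVK // subrr eqxx.
  by apply/eqP => h; rewrite h mulr0 ltxx in li1.
- have [m1 m2] := mdep; have [l1 l2] := ldep; split.
    by rewrite sumrB m1 -mulr_sumr l1 mulr0 subrr.
  rewrite (eq_bigr (fun i => m i *: p i - u *: (l i *: p i))).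
    by rewrite sumrB m2 -scaler_sumr l2 scaler0 subrr.
  by move=> i _; rewrite scalerBl scalerA.
- by exists j.
exists C', e'; split=> // i; have [h1 h2] := h i.
by split=> [/h1/vpos|/h2/vneg].
Qed.

Definition bary_coords s x m :=
  [/\ forall i, i \notin s -> m i = 0, \sum_i m i = 1 & \sum_i m i *: p i = x].

Definition bary s x : 'I_n -> R := xget (fun=> 0) [set m | bary_coords s x m]%classic.

Lemma baryP s x : #|s| = d.+1 -> bary_coords s x (bary s x).
Proof.
move=> cs; have [m mP] := chirotope_span x (generic cs).
by rewrite /bary; case: xgetP => [y _ //|/(_ m)]; case.
Qed.

Lemma bary_uniq s x m : #|s| = d.+1 -> bary_coords s x m -> m =1 bary s x.
Proof.
move=> cs [m0 m1 m2] i; have [b0 b1 b2] := baryP x cs.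
apply/eqP; rewrite -subr_eq0; apply/eqP.
apply: (@generic_indep s (fun i => m i - bary s x i)); rewrite ?cs //.
  split; first by rewrite sumrB m1 b1 subrr.
  rewrite (eq_bigr (fun i => m i *: p i - bary s x i *: p i)).
    by rewrite sumrB m2 b2 subrr.
  by move=> j _; rewrite scalerBl.
by move=> j js; rewrite m0 // b0 // subrr.
Qed.

Lemma bary_out s x i : #|s| = d.+1 -> i \notin s -> bary s x i = 0.
Proof. by move=> cs; have [+ _ _] := baryP x cs; apply. Qed.

Lemma bary_comb (I : finType) s (c : I -> R) (q : I -> 'rV[R]_d) i :
  #|s| = d.+1 -> \sum_k c k = 1 ->
  bary s (\sum_k c k *: q k) i = \sum_k c k * bary s (q k) i.
Proof.
move=> cs c1; symmetry; apply: (bary_uniq (m := fun i => _)) => //; split.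
- by move=> j js; rewrite big1 // => k _; rewrite bary_out // mulr0.
- rewrite exchange_big /= -[RHS]c1; apply: eq_bigr => k _.
  by have [_ b1 _] := baryP (q k) cs; rewrite -mulr_sumr b1 mulr1.
under eq_bigr do rewrite scaler_suml.
rewrite exchange_big /=; apply: eq_bigr => k _.
have [_ _ b2] := baryP (q k) cs.
by rewrite -[in RHS]b2 scaler_sumr; apply: eq_bigr => j _; rewrite scalerA.
Qed.

Lemma bary_segment s x y (t : R) i : #|s| = d.+1 ->
  bary s ((1 - t) *: x + t *: y) i = (1 - t) * bary s x i + t * bary s y i.
Proof.
move=> cs.
have := @bary_comb bool s (fun b => if b then t else 1 - t) (fun b => if b then y else x) i cs.
by rewrite !big_bool /= ![t *: _ + _]addrC ![t * _ + _]addrC; apply; lra.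
Qed.

Lemma bary_vertex s i j : #|s| = d.+1 -> j \in s -> bary s (p j) i = (i == j)%:R.
Proof.
move=> cs js; symmetry; apply: (bary_uniq (m := fun i => (i == j)%:R)) => //; split.
- by move=> k; case: eqP => // ->; rewrite js.
- by rewrite (bigD1 j) //= eqxx big1 ?addr0 // => k /negPf ->.
rewrite (bigD1 j) //= eqxx scale1r big1 ?addr0 // => k /negPf ->.
by rewrite scale0r.
Qed.

Lemma sum_in_set (V : zmodType) s (F : 'I_n -> V) :
  (forall i, i \notin s -> F i = 0) -> \sum_(i in s) F i = \sum_i F i.
Proof.
move=> F0; rewrite [RHS](bigID (mem s)) /= [X in _ + X]big1 ?addr0 //.
Qed.

Lemma conv_hullP s x : #|s| = d.+1 ->
  conv_hull p s x <-> (forall i, 0 <= bary s x i).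
Proof.
move=> cs; split=> [[l [l0 l1 l2]] i|b0].
  have := @bary_uniq s x (fun i => if i \in s then l i else 0) cs.
  move=> <-; first by case: ifP => // /l0.
  split=> [j /negPf -> //||].
    by rewrite -big_mkcond.
  rewrite -l2 [RHS]big_mkcond; apply: eq_bigr => j _.
  by case: ifP; rewrite ?scale0r.
have [m0 m1 m2] := baryP x cs.
exists (bary s x); split => //.
  by rewrite sum_in_set.
by rewrite sum_in_set // => i /m0 ->; rewrite scale0r.
Qed.

Lemma spanning s : #|s| = d.+1 -> affinely_spanning p s.
Proof.
move=> cs x; have [m0 m1 m2] := baryP x cs; exists (bary s x); split.
  by rewrite sum_in_set.
by rewrite sum_in_set // => i /m0 ->; rewrite scale0r.
Qed.

Lemma dependence_restrict S l : affine_dependence p S l ->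
  dependence p (fun i => if i \in S then l i else 0).
Proof.
case=> h1 h2; split; first by rewrite -big_mkcond.
rewrite -[RHS]h1 [RHS]big_mkcond; apply: eq_bigr => i _.
by case: ifP; rewrite ?scale0r.
Qed.

Lemma independent S : (#|S| <= d.+1)%N -> affinely_independent p S.
Proof.
move=> cS l /dependence_restrict ldep i iS.
have l0 j : j \notin S -> (if j \in S then l j else 0) = 0 by move/negPf=> ->.
by have := generic_indep cS ldep l0 i; rewrite iS.
Qed.

Lemma generic_general_position : general_position p.
Proof.
move=> S cS [a [b [a0 ab]]]; case/eqP: a0.
have eq_b x : (x *m a) 0 0 = b.
  have [m0 m1 m2] := baryP x cS.
  rewrite -m2 mulmx_suml summxE -[RHS]mul1r -m1 mulr_suml; apply: eq_bigr => i _.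
  rewrite -scalemxAl mxE; have [/ab ->//|/m0 ->] := boolP (i \in S).
  by rewrite !mul0r.
have b0 : b = 0 by rewrite -(eq_b 0) mul0mx mxE.
apply/matrixP => i j; rewrite ord1 !mxE -b0 -(eq_b (delta_mx 0 i)).
by rewrite -rowE mxE.
Qed.

Definition circuit_pos C : {set 'I_n} := [set i | 0 < circuit_dep p C i].
Definition circuit_neg C : {set 'I_n} := [set i | circuit_dep p C i < 0].

(** By [conformal_circuit], the negation of this says that the two simplices
    meet along their common face. *)
Definition crossing s s' := exists C, [/\ #|C| = d.+2,
  circuit_pos C \subset s & circuit_neg C \subset s'].

Lemma bary_agree s s' x : #|s| = d.+1 -> #|s'| = d.+1 ->
  ~ crossing s s' -> ~ crossing s' s ->
  conv_hull p s x -> conv_hull p s' x -> bary s x =1 bary s' x.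
Proof.
move=> cs cs' ss' s's /conv_hullP-/(_ cs) b0 /conv_hullP-/(_ cs') b0' i.
have [b1 b2 b3] := baryP x cs; have [c1 c2 c3] := baryP x cs'.
apply/eqP; rewrite -subr_eq0; apply/negPn/negP => bi.
pose m i := bary s x i - bary s' x i.
have mdep : dependence p m.
  split; first by rewrite sumrB b2 c2 subrr.
  rewrite (eq_bigr (fun i => bary s x i *: p i - bary s' x i *: p i)).
    by rewrite sumrB b3 c3 subrr.
  by move=> j _; rewrite scalerBl.
have mpos j : 0 < m j -> j \in s.
  move=> mj; apply/negPn/negP => /b1 bj; move: mj (b0' j); rewrite /m bj; lra.
have mneg j : m j < 0 -> j \in s'.
  move=> mj; apply/negPn/negP => /c1 bj; move: mj (b0 j); rewrite /m bj; lra.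
have [|C [e [cC Cm]]] := conformal_circuit mdep; first by exists i.
case: e Cm => Cm.
  apply: s's; exists C; split=> //; apply/subsetP => j; rewrite inE => cj;
    have := Cm j; rewrite expr1 mulN1r oppr_gt0 oppr_lt0 => -[h1 h2].
    exact/mneg/h2.
  exact/mpos/h1.
apply: ss'; exists C; split=> //; apply/subsetP => j; rewrite inE => cj;
  have := Cm j; rewrite expr0 mul1r => -[h1 h2].
  exact/mpos/h1.
exact/mneg/h2.
Qed.

(** Faces are defined by linear functionals, which have to be read off from the
    barycentric coordinates. *)
Lemma bary_linear s x i : #|s| = d.+1 ->
  bary s x i = bary s 0 i + \sum_k x 0 k * (bary s (delta_mx 0 k) i - bary s 0 i).
Proof.
move=> cs; pose c (o : option 'I_d) := if o is Some k then x 0 k else 1 - \sum_k x 0 k.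
pose q (o : option 'I_d) : 'rV[R]_d := if o is Some k then delta_mx 0 k else 0.
have splito (V : zmodType) (F : option 'I_d -> V) :
    \sum_o F o = F None + \sum_k F (Some k).
  rewrite (bigD1 None) //=; congr (_ + _).
  rewrite (reindex_omap Some id); last by case.
  by apply: eq_bigl => k; rewrite /= eqxx.
have := @bary_comb _ s c q i cs; rewrite !splito /= subrK => /(_ erefl).
rewrite scaler0 add0r -row_sum_delta => ->.
under [in RHS]eq_bigr do rewrite mulrBr.
rewrite sumrB -mulr_suml; ring.
Qed.

(** The functional cutting out the face is minus the sum of the barycentric
    coordinates of the vertices in [s :\: s']. *)
Lemma face_of_agree s s' : #|s| = d.+1 -> #|s'| = d.+1 ->
  (forall x, conv_hull p s x -> conv_hull p s' x -> bary s x =1 bary s' x) ->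
  is_face (conv_hull p s `&` conv_hull p s')%classic (conv_hull p s).
Proof.
move=> cs cs' agree.
pose f x := \sum_(i in s :\: s') bary s x i.
exists (\col_k (f 0 - f (delta_mx 0 k))), (f 0).
have fE x : (x *m \col_k (f 0 - f (delta_mx 0 k))) 0 0 = f 0 - f x.
  rewrite mxE [in RHS]/f; under [X in _ = _ - X]eq_bigr do rewrite bary_linear //.
  rewrite big_split /= opprD addNKr exchange_big /= -sumrN; apply: eq_bigr => k _.
  by rewrite mxE -mulr_sumr sumrB -mulrN opprB.
have f0 x : conv_hull p s x -> 0 <= f x.
  by move=> /conv_hullP-/(_ cs) b0; apply: sumr_ge0.
split=> [x /f0|]; first by rewrite fE; lra.
apply/seteqP; split=> [x [sx s'x]|x [sx] /=].
  split=> //=; rewrite fE [f x]big1 ?subr0 // => i; rewrite inE => /andP[is' _].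
  by rewrite (agree x) // bary_out.
rewrite fE => fx0; split=> //; apply/conv_hullP => // i.
have {fx0} fx0 : f x = 0 by lra.
move: (sx) => /conv_hullP-/(_ cs) b0.
rewrite -(@bary_uniq s' x (bary s x)) //.
have [b1 b2 b3] := baryP x cs; split=> // j js'.
have [js|/b1 //] := boolP (j \in s).
by move/psumr_eq0P: fx0; apply=> //; rewrite inE js js'.
Qed.

(** The pivot formula for replacing the vertex [c] of [s] by [q]. *)
Lemma bary_exchange s c q x i : #|s| = d.+1 -> c \in s -> q \notin s ->
  bary s (p q) c != 0 ->
  bary (q |: (s :\ c)) x i =
    if i == q then bary s x c / bary s (p q) c
    else bary s x i - bary s x c / bary s (p q) c * bary s (p q) i.
Proof.
move=> cs cins qs ac0.
have cq : c != q by apply: contraNneq qs => <-.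
have cs' : #|q |: (s :\ c)| = d.+1.
  rewrite cardsU1 !inE (negPf qs) andbF /=.
  by have := cardsD1 c s; rewrite cins cs => -[->].
have [b1 b2 b3] := baryP x cs; have [a1 a2 a3] := baryP (p q) cs.
set t := bary s x c / bary s (p q) c.
pose m i := bary s x i + t * ((i == q)%:R - bary s (p q) i).
transitivity (m i); last first.
  rewrite /m; case: eqP => [->|_]; last by rewrite sub0r mulrN.
  by rewrite b1 // a1 // subr0 mulr1 add0r.
symmetry; apply: (bary_uniq (m := m)) => //.
have delta_sum (V : zmodType) (F : 'I_n -> V) : \sum_i F i *+ (i == q) = F q.
  by rewrite (bigD1 q) //= eqxx big1 ?addr0 // => k /negPf ->.
split=> [j||].
- rewrite !inE negb_or negb_and negbK => /andP[jq /orP[/eqP ->|js]].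
    by rewrite /m (negPf cq) /t sub0r mulrN mulfVK // subrr.
  by rewrite /m b1 // a1 // (negPf jq) subrr mulr0 addr0.
- by rewrite big_split /= -mulr_sumr sumrB b2 a2 delta_sum subrr mulr0 addr0.
rewrite (eq_bigr (fun i => bary s x i *: p i +
   t *: ((p i *+ (i == q)) - bary s (p q) i *: p i))).
  by rewrite big_split /= -scaler_sumr sumrB b3 a3 delta_sum subrr scaler0 addr0.
by move=> j _; rewrite scalerDl -scalerA scalerBl scaler_nat.
Qed.

Lemma bary_of_dependence s q l i : #|s| = d.+1 -> q \notin s -> i != q ->
  dependence p l -> l q != 0 -> (forall j, j \notin q |: s -> l j = 0) ->
  bary s (p q) i = - (l i / l q).
Proof.
move=> cs qs iq ldep lq lout.
rewrite -(@bary_uniq s (p q) (fun i => (i == q)%:R - l i / l q)) //.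
  by rewrite (negPf iq) sub0r.
have [l1 l2] := ldep.
have delta (V : zmodType) (F : 'I_n -> V) : \sum_l F l *+ (l == q) = F q.
  by rewrite (bigD1 q) //= eqxx big1 ?addr0 // => k /negPf ->.
split=> [j js||].
- have [->|jq] := eqVneq j q; first by rewrite divff // subrr.
  by rewrite lout ?mul0r ?subr0 // !inE negb_or jq.
- by rewrite sumrB -mulr_suml l1 mul0r subr0 delta.
rewrite (eq_bigr (fun k => p k *+ (k == q) - (l q)^-1 *: (l k *: p k))).
  by rewrite sumrB -scaler_sumr l2 scaler0 subr0 delta.
by move=> k _; rewrite scalerBl scaler_nat scalerA [l k / _]mulrC.
Qed.

Lemma bary_affine s i : #|s| = d.+1 -> affine_fun (fun x => bary s x i).
Proof. by move=> cs x y t; apply: bary_segment. Qed.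

(** * Cells that are closed under crossing facets cover the convex hull

    From a generic point of a cell, walk straight to a given point [y] of the
    convex hull. The walk leaves a cell through the relative interior of a
    facet; the facet is not in the boundary of the convex hull, since [y] lies
    behind it, so the walk enters the neighbouring cell, and it never comes back
    because cells are left at increasing times. *)

Section Cover.
Variables (T : {set {set 'I_n}}) (s0 : {set 'I_n}).
Hypothesis s0T : s0 \in T.
Hypothesis cardT : forall s, s \in T -> #|s| = d.+1.
Hypothesis adjT : forall s c, s \in T -> c \in s ->
  (forall q, 0 <= bary s (p q) c) \/
  exists q, [/\ q \notin s, q |: (s :\ c) \in T & bary s (p q) c < 0].

Section Walk.
Variables (y z : 'rV[R]_d).
Hypothesis yA : conv_hull p [set: 'I_n] y.
(** When a coordinate that is nonzero at [y] vanishes along the walk, no other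
    coordinate in the same cell does. *)
Hypothesis zgen : forall s c c', s \in T -> c \in s -> c' \in s -> c != c' ->
  bary s y c != 0 -> bary s y c' * bary s z c - bary s y c * bary s z c' != 0.
Hypothesis z0 : forall i, 0 <= bary s0 z i.

Let path (t : R) := (1 - t) *: z + t *: y.
(** The time at which the coordinate of [c] vanishes along the walk. *)
Let exit s c := bary s z c / (bary s z c - bary s y c).

Let in_cell s t := forall i, 0 <= bary s (path t) i.

Lemma path_bary s t i : s \in T ->
  bary s (path t) i = (1 - t) * bary s z i + t * bary s y i.
Proof. by move=> /cardT cs; rewrite /path bary_segment. Qed.

Lemma exit_after s t c : s \in T -> 0 <= t < 1 -> 0 <= bary s (path t) c ->
  bary s y c < 0 ->
  [/\ t <= exit s c < 1, bary s (path (exit s c)) c = 0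
    & 0 < bary s (path t) c -> t < exit s c].
Proof.
move=> sT /andP[t0 t1]; rewrite !path_bary // /exit => xt yc.
set zc := bary s z c in xt *; set yc' := bary s y c in xt yc *.
have zc0 : 0 <= zc.
  have : (1 - t) * zc >= 0 by nra.
  by rewrite pmulr_rge0 //; lra.
have D0 : 0 < zc - yc' by lra.
split; last 1 [by move=> h; rewrite ltr_pdivlMr //; nra].
  by rewrite ler_pdivlMr // ltr_pdivrMr //; apply/andP; split; nra.
by field; lra.
Qed.

(** The facet crossed first, among those that have [y] behind them. *)
Lemma leave_cell s t : s \in T -> 0 <= t < 1 -> in_cell s t -> ~ conv_hull p s y ->
  exists c, [/\ c \in s, bary s y c < 0, t <= exit s c & in_cell s (exit s c)].
Proof.
move=> sT t01 st ys.
have [c0 yc0] : exists c, bary s y c < 0.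
  apply: contrapT => h; apply: ys; apply/conv_hullP => [|i]; first exact: cardT.
  by rewrite leNgt; apply/negP => yi; apply: h; exists i.
case: (@Order.TotalTheory.arg_minP _ _ _ c0 (fun c => bary s y c < 0)
   (fun c => exit s c) yc0) => c yc cmin.
have [/andP[tc c1] xc _] := exit_after sT t01 (st c) yc.
exists c; split=> //.
  by apply: contraTT yc => /bary_out ->; rewrite ?ltxx ?cardT.
move=> i; rewrite path_bary //; have := st i; rewrite path_bary //.
case: (ltrP (bary s y i) 0) => [yi|yi].
  have [/andP[ti i1] + _] := exit_after sT t01 (st i) yi.
  have := cmin i yi; rewrite path_bary //; case/andP: t01 => t0 t1 ci xi h.
  have zi : 0 <= bary s z i.
    have : 0 <= (1 - t) * bary s z i by nra.
    by rewrite pmulr_rge0 //; lra.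
  have : 0 <= (exit s i - exit s c) * (bary s z i - bary s y i).
    by apply: mulr_ge0; lra.
  lra.
move=> h; case/andP: t01 => t0 t1.
have h1 : 0 <= (1 - exit s c) * ((1 - t) * bary s z i + t * bary s y i).
  by apply: mulr_ge0; lra.
have h2 : 0 <= (exit s c - t) * bary s y i by apply: mulr_ge0; lra.
have : 0 <= (1 - t) * ((1 - exit s c) * bary s z i + exit s c * bary s y i) by lra.
by rewrite pmulr_rge0 //; lra.
Qed.

Lemma walk_covers : exists2 s, s \in T & conv_hull p s y.
Proof.
apply: contrapT => nocell.
have out s : s \in T -> ~ conv_hull p s y by move=> sT ys; apply: nocell; exists s.
pose P (sc : {set 'I_n} * 'I_n) := [&& sc.1 \in T, bary sc.1 y sc.2 < 0,
  0 <= exit sc.1 sc.2 < 1 & [forall i, 0 <= bary sc.1 (path (exit sc.1 sc.2)) i]].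
have step s t : s \in T -> 0 <= t < 1 -> in_cell s t ->
    exists c, [/\ c \in s, P (s, c), t <= exit s c
                & 0 < bary s (path t) c -> t < exit s c].
  move=> sT t01 st; have [c [cs yc tc scell]] := leave_cell sT t01 st (out s sT).
  have [/andP[_ c1] _ strict] := exit_after sT t01 (st c) yc.
  exists c; split=> //; rewrite /P /= sT yc c1 andbT /=; apply/andP; split.
    by case/andP: t01; lra.
  exact/forallP.
have cell0 : in_cell s0 0.
  by move=> i; rewrite path_bary // subr0 mul1r mul0r addr0.
have [|c0 [_ Pc0 _ _]] := step s0 0 s0T _ cell0; first by apply/andP; split; lra.
(* instead of iterating the walk, consider the latest time at which a cell is left *)
case: (@Order.TotalTheory.arg_maxP _ _ _ (s0, c0) P (fun sc => exit sc.1 sc.2) Pc0)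
  => -[s c] /and4P[/= sT yc t01 /forallP scell] scmax.
set t := exit s c in t01 scell scmax.
have cs := cardT sT.
have cins : c \in s by apply: contraTT yc => /bary_out ->; rewrite ?ltxx.
have [_ xc _] := exit_after sT t01 (scell c) yc.
rewrite -/t in xc.
have [hull|[q [qs s'T aq]]] := adjT sT cins.
  have [l [l0 l1 ly]] := yA.
  have l1' : \sum_i l i = 1 by rewrite -l1; apply: eq_bigl => i; rewrite inE.
  have ly' : \sum_i l i *: p i = y by rewrite -ly; apply: eq_bigl => i; rewrite inE.
  move: yc; rewrite -ly' bary_comb // ltNge => /negP; apply.
  by apply: sumr_ge0 => i _; apply: mulr_ge0 => //; apply: l0; rewrite inE.
have aq0 : bary s (p q) c != 0 by rewrite lt_eqF.
set s' := q |: (s :\ c) in s'T.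
have xs' i : bary s' (path t) i = if i == q then 0 else bary s (path t) i.
  by rewrite bary_exchange // xc !mul0r subr0.
have cells' : in_cell s' t by move=> i; rewrite xs'; case: ifP.
have [c' [c's' /and4P[_ /= yc' t01' cell'] tc' strict]] := step s' t s'T t01 cells'.
have c'q : c' != q.
  apply: contraTneq yc' => ->; rewrite bary_exchange // eqxx -leNgt.
  by apply: mulr_le0; rewrite ?invr_le0 ltW.
have /setD1P[c'c c'ins] : c' \in s :\ c by move: c's'; rewrite !inE (negPf c'q).
have xc' : bary s (path t) c' != 0.
  have := zgen sT cins c'ins; rewrite eq_sym => /(_ c'c); rewrite lt_eqF // => /(_ isT).
  apply: contraNneq => xc'.
  move: xc xc'; rewrite !path_bary // => xc xc'.
  have : (1 - t) * (bary s y c' * bary s z c - bary s y c * bary s z c') == 0.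
    rewrite (_ : (1 - t) * (_ - _) = bary s y c' * ((1 - t) * bary s z c + t * bary s y c)
        - bary s y c * ((1 - t) * bary s z c' + t * bary s y c')); last by ring.
    by rewrite xc xc' !mulr0 subrr.
  by rewrite mulf_eq0 => /orP[/eqP|//]; case/andP: t01; lra.
have : t < exit s' c'.
  by apply: strict; rewrite xs' (negPf c'q) lt_def xc' scell.
have := scmax (s', c'); rewrite /P /= s'T yc' t01' cell' => /(_ isT); lra.
Qed.

End Walk.

(** The genericity conditions are the nonvanishing of finitely many affine
    functionals, none of which is identically zero. *)
Lemma cells_cover y : conv_hull p [set: 'I_n] y -> exists2 s, s \in T & conv_hull p s y.
Proof.
move=> yA.
pose l := [seq scc <- enum {: {set 'I_n} * 'I_n * 'I_n} |
  [&& scc.1.1 \in T, scc.1.2 \in scc.1.1, scc.2 \in scc.1.1, scc.1.2 != scc.2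
    & bary scc.1.1 y scc.1.2 != 0]].
have cs0 := cardT s0T.
pose f scc z := if scc \in l then bary scc.1.1 y scc.2 * bary scc.1.1 z scc.1.2
   - bary scc.1.1 y scc.1.2 * bary scc.1.1 z scc.2 else 0.
pose w i : R := if i \in s0 then (d.+1%:R)^-1 else 0.
have wE : w =1 bary s0 (\sum_i w i *: p i).
  apply: bary_uniq => //; split=> //; first by rewrite /w => i /negPf ->.
  rewrite -(@sum_in_set _ s0); last by rewrite /w => i /negPf ->.
  rewrite (eq_bigr (fun=> (d.+1%:R)^-1)); last by rewrite /w => i ->.
  by rewrite sumr_const cs0 -[X in X = _]mulr_natr mulVf // pnatr_eq0.
have [||||z [fz gz]] := @generic_point R _ _ _ f (fun i z => bary s0 z i) l (enum s0)
   (\sum_i w i *: p i).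
- move=> scc u v t; rewrite /f; case: ifP => [|_]; last by rewrite !mulr0 addr0.
  by rewrite mem_filter => /andP[/andP[/cardT cs _] _]; rewrite !bary_segment //; ring.
- by move=> i; apply: bary_affine.
- move=> [[s c] c'] il; exists (p c'); rewrite /f il.
  move: il; rewrite mem_filter /= => /andP[/and5P[/cardT cs cins c's cc' yc] _].
  by rewrite !bary_vertex // eqxx (negPf cc') mulr0 mulr1 sub0r oppr_eq0.
- move=> j; rewrite mem_enum => js.
  by rewrite -wE /w js invr_gt0 ltr0n.
apply: (@walk_covers y z yA) => [s c c' sT cins c's cc' yc|i].
  have il : ((s, c), c') \in l by rewrite mem_filter /= sT cins c's cc' yc mem_enum.
  by have := fz _ il; rewrite /f il.
have [is0|/(bary_out z cs0) -> //] := boolP (i \in s0).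
by rewrite ltW // gz // mem_enum.
Qed.

End Cover.

(** Covering comes from the walk, and the cells meet along common faces because
    the barycentric coordinates with respect to two cells agree on their
    intersection. *)
Theorem triangulation_criterion (T : {set {set 'I_n}}) :
  T != set0 -> (forall s, s \in T -> #|s| = d.+1) ->
  (forall s c, s \in T -> c \in s ->
    (forall q, 0 <= bary s (p q) c) \/
    exists q, [/\ q \notin s, q |: (s :\ c) \in T & bary s (p q) c < 0]) ->
  (forall s s', s \in T -> s' \in T -> ~ crossing s s') ->
  is_triangulation p T.
Proof.
move=> /set0Pn[s0 s0T] cardT adjT crossT; split.
- move=> s /cardT cs; split; first exact: spanning.
  by apply: independent; rewrite cs.
- move=> s s' sT s'T; have cs := cardT s sT; have cs' := cardT s' s'T.
  have agree x : conv_hull p s x -> conv_hull p s' x -> bary s x =1 bary s' x.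
    by apply: bary_agree; auto.
  split; first exact: face_of_agree.
  rewrite classical_sets.setIC; apply: face_of_agree => // x s'x sx i.
  by rewrite agree.
apply/seteqP; split=> [x [s /= sT [l [l0 l1 l2]]]|x /(cells_cover s0T cardT adjT)[s sT sx]].
  have sumT (V : zmodType) (F : 'I_n -> V) : \sum_(i in [set: 'I_n]) F i = \sum_i F i.
    by apply: eq_bigl => i; rewrite inE.
  exists (fun i => if i \in s then l i else 0); split.
  - by move=> i _; case: ifP => // /l0.
  - by rewrite sumT -big_mkcond.
  by rewrite -l2 [in RHS]big_mkcond sumT; apply: eq_bigr => i _; case: ifP; rewrite ?scale0r.
by exists s.
Qed.

(** * Sets of cells that no flip can remove *)

Section Frozen.
Hypothesis d_gt0 : (0 < d)%N.

Lemma points_neq i j : i != j -> p i != p j.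
Proof.
move=> ij; apply/eqP => pij.
have delta (V : zmodType) (F : 'I_n -> V) k : \sum_l F l *+ (l == k) = F k.
  by rewrite (bigD1 k) //= eqxx big1 ?addr0 // => l /negPf ->.
have cij : (#|[set i; j]| <= d.+1)%N by rewrite cards2 ij.
have i0 : forall k, (k == i)%:R - (k == j)%:R = 0 :> R.
  apply: (generic_indep cij) => [|k]; last first.
    by rewrite !inE negb_or => /andP[/negPf -> /negPf ->]; rewrite subrr.
  split; first by rewrite sumrB !delta subrr.
  rewrite (eq_bigr (fun k => p k *+ (k == i) - p k *+ (k == j))).
    by rewrite sumrB !delta pij subrr.
  by move=> k _; rewrite scalerBl !scaler_nat.
by have := i0 i; rewrite eqxx (negPf ij) subr0 => /eqP; rewrite oner_eq0.
Qed.

(** A face that contains a convex combination contains all the points that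
    occur in it with positive weight. *)
Lemma face_vertex (F : set 'rV[R]_d) s (w : 'I_n -> R) :
  is_face F (conv_hull p s) -> #|s| = d.+1 ->
  (forall i, 0 <= w i) -> (forall i, i \notin s -> w i = 0) -> \sum_i w i = 1 ->
  F (\sum_i w i *: p i) -> forall i, 0 < w i -> F (p i).
Proof.
move=> [a [b [ab ->]]] cs w0 ws w1 [_ /= xb] i wi.
have pc j : j \in s -> conv_hull p s (p j).
  by move=> js; apply/conv_hullP => // k; rewrite bary_vertex // ler0n.
have wis : i \in s by apply: contraTT wi => /ws ->; rewrite ltxx.
split; first exact: pc.
have sum0 : \sum_j w j * (b - (p j *m a) 0 0) = 0.
  under eq_bigr do rewrite mulrBr.
  rewrite sumrB -mulr_suml w1 mul1r -xb mulmx_suml summxE.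
  by apply/eqP; rewrite subr_eq0; apply/eqP/eq_bigr => j _; rewrite -scalemxAl mxE.
have /psumr_eq0P : forall j, true -> 0 <= w j * (b - (p j *m a) 0 0).
  move=> j _; have [js|/ws ->] := boolP (j \in s); last by rewrite mul0r.
  by apply: mulr_ge0 => //; have := ab _ (pc j js); lra.
move=> /(_ sum0 i isT)/eqP; rewrite mulf_eq0 gt_eqF //= subr_eq0 => /eqP ->.
by [].
Qed.

(** A larger cell would contain a circuit, and a smaller one would lie in a
    proper face of a simplex and could not span. *)
Lemma card_cell T s : is_triangulation p T -> s \in T -> #|s| = d.+1.
Proof.
move=> [cells _ _] sT; have [span indep] := cells s sT; apply/eqP; rewrite eqn_leq; apply/andP; split.
  rewrite leqNgt; apply/negP => /subset_of_card[C Cs cC].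
  have [i iC] : exists i, i \in C by apply/set0Pn; rewrite -card_gt0 cC.
  have out j : j \notin s -> circuit_dep p C j = 0.
    by move=> js; apply: circuit_dep_out; apply: contra js; apply/subsetP.
  have [c1 c2] := circuit_dependence p C.
  have := indep (circuit_dep p C); rewrite /affine_dependence !sum_in_set //.
    move=> /(_ (conj c2 c1) i (subsetP Cs _ iC)) /eqP.
    by apply/negP; rewrite circuit_dep_neq0.
  by move=> j /out ->; rewrite scale0r.
rewrite leqNgt; apply/negP => cs.
have [|S sS cS] := @superset_of_card _ s d.+1; first by rewrite card_ord ltnW.
have /subsetPn[i iS is_] : ~~ (S \subset s).
  by apply/negP => /subset_leq_card; rewrite cS leqNgt cs.
have [l [l1 l2]] := span (p i).
have := bary_vertex i cS iS; rewrite eqxx -(@bary_uniq S _ (fun j => if j \in s then l j else 0)) //.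
  by rewrite (negPf is_) => /esym/eqP; rewrite oner_eq0.
split=> [j jS||].
- by case: ifP => // /(subsetP sS); rewrite (negPf jS).
- by rewrite -big_mkcond.
by rewrite -l2 [in RHS]big_mkcond; apply: eq_bigr => j _; case: ifP; rewrite ?scale0r.
Qed.

(** The positive and the negative half of [m] have a common barycentre, which
    lies in both simplices. If [i] has positive weight, then [p i] is in
    their intersection and so are the vertices of [s'] of which it is a convex
    combination; as [p i] is a vertex of [s], these vertices coincide with it. *)
Lemma triangulation_dependence T s s' m : is_triangulation p T ->
  s \in T -> s' \in T -> dependence p m ->
  (forall i, 0 < m i -> i \in s) -> (forall i, m i < 0 -> i \in s') ->
  forall i, 0 < m i -> i \in s'.
Proof.
move=> triT sT s'T [m0 mp] ms ms' i mi.
have cs := card_cell triT sT; have cs' := card_cell triT s'T.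
apply/negPn/negP => is'; have is_ := ms i mi.
have [_ faceT _] := triT; have [face face'] := faceT s s' sT s'T.
pose pp j := Num.max (m j) 0; pose np j := Num.max (- m j) 0.
have pn j : m j = pp j - np j by rewrite /pp /np -[X in _ - Num.max _ X]oppr0 -oppr_min opprK addr_max_min addr0.
have pp0 j : 0 <= pp j by rewrite le_max lexx orbT.
have np0 j : 0 <= np j by rewrite le_max lexx orbT.
pose M := \sum_j pp j.
have M0 : 0 < M.
  rewrite /M (bigD1 i) //=; apply: ltr_pwDl; first by rewrite lt_max mi.
  exact: sumr_ge0.
have MN : \sum_j np j = M.
  by apply/esym/eqP; rewrite -subr_eq0 -sumrB -[X in _ == X]m0; apply/eqP/eq_bigr.
have eq_x : \sum_j (pp j / M) *: p j = \sum_j (np j / M) *: p j.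
  apply/eqP; rewrite -subr_eq0 -sumrB.
  rewrite (eq_bigr (fun j => M^-1 *: (m j *: p j))).
    by rewrite -scaler_sumr mp scaler0.
  by move=> j _; rewrite -scalerBl -mulrBl -pn scalerA mulrC.
set x := \sum_j _ in eq_x.
have pps j : j \notin s -> pp j / M = 0.
  move=> js; rewrite /pp; case: (ltrP 0 (m j)) => [/ms|mj]; first by rewrite (negPf js).
  by rewrite mul0r.
have nps j : j \notin s' -> np j / M = 0.
  move=> js; rewrite /np; case: (ltrP (m j) 0) => [/ms'|mj]; first by rewrite (negPf js).
  by rewrite max_r ?oppr_le0 // mul0r.
have sumM w : \sum_j w j = M -> \sum_j w j / M = 1.
  by move=> wM; rewrite -mulr_suml wM mulfV // gt_eqF.
have sx : conv_hull p s x.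
  exists (fun j => pp j / M); split=> [j _||].
  - by rewrite divr_ge0 // ltW.
  - by rewrite sum_in_set // sumM.
  by rewrite sum_in_set // => j /pps ->; rewrite scale0r.
have s'x : conv_hull p s' x.
  exists (fun j => np j / M); split=> [j _||].
  - by rewrite divr_ge0 // ltW.
  - by rewrite sum_in_set // sumM.
  by rewrite sum_in_set ?eq_x // => j /nps ->; rewrite scale0r.
have [_ s'i] : (conv_hull p s `&` conv_hull p s')%classic (p i).
  apply: (face_vertex face (w := fun j => pp j / M)) => //.
  - by move=> j; rewrite divr_ge0 // ltW.
  - exact: sumM.
  - by rewrite divr_gt0 // lt_max mi.
have [l0 l1 lp] := baryP (p i) cs'; set l := bary s' (p i) in l0 l1 lp.
have /conv_hullP-/(_ cs') lge := s'i.
have sj j : 0 < l j -> conv_hull p s (p j).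
  move=> lj; suff [] : (conv_hull p s `&` conv_hull p s')%classic (p j) by [].
  apply: (face_vertex face' (w := l)) => //; rewrite lp.
  by split=> //; apply/conv_hullP => // k; rewrite bary_vertex // ler0n.
have [j lj] : exists j, 0 < l j.
  apply: contrapT => nol; have := l1; rewrite big1 => [/esym/eqP|j _].
    by rewrite oner_eq0.
  by apply/eqP; rewrite eq_le lge andbT leNgt; apply/negP => lj; apply: nol; exists j.
have sumb k : \sum_i bary s (p k) i = 1 by have [] := baryP (p k) cs.
have le1 k : 0 < l k -> bary s (p k) i <= 1.
  move=> /sj /conv_hullP-/(_ cs) bk.
  by rewrite -(sumb k) (bigD1 i) //= lerDl sumr_ge0.
have sum0 : \sum_k l k * (1 - bary s (p k) i) = 0.
  under eq_bigr do rewrite mulrBr mulr1.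
  rewrite sumrB l1 -(@bary_comb _ s l p) // lp bary_vertex // eqxx subrr //.
have /psumr_eq0P/(_ sum0 j isT)/eqP : forall k, true -> 0 <= l k * (1 - bary s (p k) i).
  move=> k _; have := lge k; rewrite -/(l k) le_eqVlt => /predU1P[<-|lk].
    by rewrite mul0r.
  by rewrite mulr_ge0 ?subr_ge0 ?le1 // ltW.
rewrite mulf_eq0 gt_eqF //= subr_eq0 => /eqP bj1.
have ij : j != i by apply: contraTneq lj => ->; rewrite l0 // ltxx.
have /negP[] := points_neq ij; apply/eqP.
have [_ _ <-] := baryP (p j) cs.
have /conv_hullP-/(_ cs) bj := sj j lj.
have bj0 k : k != i -> bary s (p j) k = 0.
  have : \sum_(k | k != i) bary s (p j) k = 0.
    by have := sumb j; rewrite (bigD1 i) //= -bj1; lra.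
  by move/psumr_eq0P => h; apply: h.
by rewrite (bigD1 i) //= -bj1 scale1r big1 ?addr0 // => k /bj0 ->; rewrite scale0r.
Qed.

(** [frozen] provides the facet [s :\ c]: the cells [q |: (s :\ c)], removed by
    the flip, and [c' |: (s :\ c)], in the core, would lie on the same side of it.
    The dependence [m] of the proof, which contains [q] and [c'] with opposite
    signs and not [c], contradicts [triangulation_dependence]. *)
Lemma frozen_no_removal T T0 s q l : is_triangulation p T -> T0 \subset T ->
  (forall s q, s \in T0 -> q \notin s -> exists c c',
    [/\ c \in s, c' \notin s, c' != q, c' |: (s :\ c) \in T0
      & bary s (p q) c < 0 /\ bary s (p c') c < 0]) ->
  s \in T0 -> q \notin s -> dependence p l -> l q != 0 ->
  (forall i, i \notin q |: s -> l i = 0) ->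
  ~ (forall c, c \in q |: s -> 0 < l c * l q -> (q |: s) :\ c \in T).
Proof.
move=> triT /subsetP T0T frozen sT0 qs ldep lq lout removed.
have cs := card_cell triT (T0T _ sT0).
have [c [c' [cins c's c'q s'T0 [aq ac']]]] := frozen s q sT0 qs.
have cq : c != q by apply: contraTneq cins => ->.
have cc' : c != c' by apply: contraTneq cins => ->.
have lqE i : i != q -> bary s (p q) i = - (l i / l q).
  by move=> iq; apply: bary_of_dependence.
have sT : q |: (s :\ c) \in T.
  have -> : q |: (s :\ c) = (q |: s) :\ c.
    by apply/setP => i; rewrite !inE; case: (i =P c) => [->|]; rewrite ?(negPf cq).
  apply: removed; first by rewrite !inE cins orbT.
  move: aq; rewrite lqE // oppr_lt0 => h.
  have -> : l c * l q = l c / l q * l q ^+ 2 by field.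
  by rewrite mulr_gt0 // exprn_even_gt0.
have s'T := T0T _ s'T0.
pose m i := ((i == q)%:R - bary s (p q) i) / - bary s (p q) c
          - ((i == c')%:R - bary s (p c') i) / - bary s (p c') c.
have diff0 k : dependence p (fun i => (i == k)%:R - bary s (p k) i).
  have delta (V : zmodType) (F : 'I_n -> V) : \sum_l F l *+ (l == k) = F k.
    by rewrite (bigD1 k) //= eqxx big1 ?addr0 // => j /negPf ->.
  have [_ b1 b2] := baryP (p k) cs; split; first by rewrite sumrB b1 delta subrr.
  rewrite (eq_bigr (fun i => p i *+ (i == k) - bary s (p k) i *: p i)).
    by rewrite sumrB b2 delta subrr.
  by move=> i _; rewrite scalerBl scaler_nat.
have mdep : dependence p m.
  have [[h1 h2] [h3 h4]] := (diff0 q, diff0 c'); split.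
    by rewrite sumrB -!mulr_suml h1 h3 !mul0r subrr.
  rewrite (eq_bigr (fun i =>
      (- bary s (p q) c)^-1 *: (((i == q)%:R - bary s (p q) i) *: p i)
    - (- bary s (p c') c)^-1 *: (((i == c')%:R - bary s (p c') i) *: p i))).
    by rewrite sumrB -!scaler_sumr h2 h4 !scaler0 subrr.
  by move=> i _; rewrite /m scalerBl !scalerA ![_^-1 * _]mulrC.
have mc : m c = 0.
  by rewrite /m (negPf cq) (negPf cc') !sub0r !mulfV ?oppr_eq0 ?lt_eqF // subrr.
have mout i : i \notin s -> i != q -> i != c' -> m i = 0.
  move=> is_ /negPf iq /negPf ic'.
  by rewrite /m iq ic' !(fun x => bary_out x cs is_) !subr0 !mul0r subr0.
have mq : 0 < m q.
  rewrite /m eqxx eq_sym (negPf c'q) !(fun x => bary_out x cs qs) !subr0 mul0r subr0.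
  by rewrite mul1r invr_gt0 oppr_gt0.
have mc' : m c' < 0.
  rewrite /m eqxx (negPf c'q) !(fun x => bary_out x cs c's) !subr0 mul0r sub0r.
  by rewrite mul1r oppr_lt0 invr_gt0 oppr_gt0.
have inF i : m i != 0 -> i != q -> i != c' -> i \in s :\ c.
  move=> mi iq ic'; rewrite !inE; apply/andP; split.
    by apply: contraNneq mi => ->; rewrite mc.
  by apply: contraNT mi => is_; rewrite mout.
suff : q \in c' |: (s :\ c) by rewrite !inE eq_sym (negPf c'q) (negPf qs) andbF.
apply: (triangulation_dependence triT sT s'T mdep) (mq) => i mi.
  rewrite !inE; have [//|iq /=] := eqVneq i q.
  have := inF i; rewrite gt_eqF // iq => /(_ isT isT); rewrite !inE; apply.
  by apply: contraTneq mi => ->; rewrite -leNgt ltW.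
rewrite !inE; have [//|ic' /=] := eqVneq i c'.
have := inF i; rewrite lt_eqF // ic' => /(_ isT); rewrite !inE; apply=> //.
by apply: contraTneq mi => ->; rewrite -leNgt ltW.
Qed.

(** Some facet [s :\ c] separates [s] from [q] and also from a cell of the set
    whose apex over this facet is not [q]. *)
Definition frozen (T0 : {set {set 'I_n}}) :=
  forall s q, s \in T0 -> q \notin s -> exists c c',
    [/\ c \in s, c' \notin s, c' != q, c' |: (s :\ c) \in T0
      & bary s (p q) c < 0 /\ bary s (p c') c < 0].

Lemma card_circuit C : is_circuit p C -> #|C| = d.+2.
Proof.
move=> [dep min]; apply/eqP; rewrite eqn_leq; apply/andP; split; last first.
  by rewrite ltnNge; apply/negP => /independent.
rewrite leqNgt; apply/negP => cC.
have [D DC cD] := subset_of_card (ltnW cC).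
have [i iD] : exists i, i \in D by apply/set0Pn; rewrite -card_gt0 cD.
have DpC : D \proper C by rewrite properEcard DC cD.
have out j : j \notin D -> circuit_dep p D j = 0 by exact: circuit_dep_out.
have [c1 c2] := circuit_dependence p D.
have := min D DpC (circuit_dep p D); rewrite /affine_dependence !sum_in_set //.
  move=> /(_ (conj c2 c1) i iD) /eqP.
  by apply/negP; rewrite circuit_dep_neq0.
by move=> j /out ->; rewrite scale0r.
Qed.

Section Invariance.
Variable T0 : {set {set 'I_n}}.
Hypothesis T0frozen : frozen T0.

(** The sets [C :\ c] with [c] of the same sign as [q] are those that
    a flip on [C] removes together with [s]. *)
Lemma frozen_flip_circuit T C l s q : is_triangulation p T -> T0 \subset T ->
  affine_dependence p C l -> (forall i, i \in C -> l i != 0) ->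
  q \in C -> s \in T0 -> s = C :\ q ->
  ~ (forall c, c \in C -> 0 < l c * l q -> C :\ c \in T).
Proof.
move=> triT T0T ldep ln0 qC sT0 sE removed.
have CE : C = q |: s by rewrite sE finset.setD1K.
pose m i := if i \in C then l i else 0.
apply: (@frozen_no_removal T T0 s q m) => //.
- by rewrite sE !inE eqxx.
- exact: dependence_restrict.
- by rewrite /m qC ln0.
- by move=> i; rewrite -CE /m => /negPf ->.
move=> c; rewrite -CE => cC; rewrite /m cC qC; exact: removed.
Qed.

Lemma subset_card_eq (A B : {set 'I_n}) : A \subset B -> #|A| = #|B| -> A = B.
Proof. by move=> AB cAB; apply/eqP; rewrite eqEcard AB cAB leqnn. Qed.

(** In general position a circuit has two more points than the dimension, so the
    sets [C :\ c] are full cells and the common link is the empty set alone. The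
    converse is the same argument with the two signs of the circuit
    exchanged. *)
Lemma flip_keeps_frozen T1 T2 : is_triangulation p T1 -> is_triangulation p T2 ->
  is_flip p T1 T2 -> T0 \subset T1 <-> T0 \subset T2.
Proof.
move=> tri1 tri2 [C [l [L [circ [ldep ln0] _ linkL T2E]]]].
have cC := card_circuit circ.
have cCD q : q \in C -> #|C :\ q| = d.+1.
  by move=> qC; have := cardsD1 q C; rewrite qC cC => -[].
have cell s r q : s = r :|: (C :\ q) -> #|s| = d.+1 -> q \in C ->
    s = C :\ q /\ r \subset s.
  move=> sE cs qC; split; last by rewrite sE finset.subsetUl.
  apply/esym/subset_card_eq; last by rewrite cs cCD.
  by rewrite sE finset.subsetUr.
have link0 t r : t \in circuit_triangulation C (pos_part C l) -> r \in L -> r = set0.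
  move=> tpos; rewrite -(linkL t tpos) inE => /andP[dis rT].
  have [q] := imsetP tpos; rewrite inE => /andP[qC _] tE.
  have [E rs] := cell _ r q (congr1 (fun t => r :|: t) tE) (card_cell tri1 rT) qC.
  rewrite E in rs; apply/eqP; rewrite -subset0 -(setIid r).
  by move: dis; rewrite -setI_eq0 tE => /eqP <-; apply: finset.setIS.
split=> [T01|T02]; apply/subsetP => s sT0.
  have sT1 := subsetP T01 s sT0.
  apply/negPn/negP; rewrite T2E !inE negb_or negb_and sT1 orbF negbK => /andP[/imset2P].
  case=> r t rL tpos sE _.
  have [q] := imsetP tpos; rewrite inE => /andP[qC lq] tE.
  have [E rs] := cell s r q (eq_trans sE (congr1 (fun t => r :|: t) tE)) (card_cell tri1 sT1) qC.
  apply: (frozen_flip_circuit tri1 T01 ldep ln0 qC sT0 E) => c cinC; rewrite pmulr_lgt0 // => lc.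
  have cpos : C :\ c \in circuit_triangulation C (pos_part C l).
    by apply: imset_f; rewrite inE cinC.
  have := rL; rewrite -(linkL _ cpos) inE (link0 t r tpos rL) finset.set0U => /andP[].
  by [].
have sT2 := subsetP T02 s sT0.
apply/negPn/negP => sT1; move: sT2; rewrite {1}T2E !inE (negPf sT1) andbF /= => /imset2P.
case=> r t rL tneg sE.
have [q] := imsetP tneg; rewrite inE => /andP[qC lq] tE.
have sT2 := subsetP T02 s sT0.
have [E rs] := cell s r q (eq_trans sE (congr1 (fun t => r :|: t) tE)) (card_cell tri2 sT2) qC.
have [k kC lk] : exists2 k, k \in C & 0 < l k.
  apply: contrapT => nopos; have [_ l0] := ldep.
  move: l0; rewrite (bigD1 q) //=; apply/eqP; rewrite lt_eqF //.
  apply: ltr_wnDr lq; apply: sumr_le0 => i /andP[iC _].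
  by rewrite leNgt; apply/negP => li; apply: nopos; exists i.
have r0 : r = set0.
  by apply: (link0 (C :\ k) r) => //; apply: imset_f; rewrite inE kC.
apply: (frozen_flip_circuit tri2 T02 ldep ln0 qC sT0 E) => c cinC; rewrite nmulr_lgt0 // => lc.
rewrite T2E inE; apply/orP; right; apply/imset2P; exists set0 (C :\ c).
- by rewrite -r0.
- by apply: imset_f; rewrite inE cinC.
- by rewrite finset.set0U.
Qed.

Lemma frozen_disconnected T1 T2 : is_triangulation p T1 -> is_triangulation p T2 ->
  T0 \subset T1 -> ~~ (T0 \subset T2) -> ~ flip_graph_connected p.
Proof.
move=> tri1 tri2 T01 T02 /(_ T1 T2 tri1 tri2) /connectP[path edges lastE].
case/negP: T02; rewrite lastE {lastE tri1 tri2 T2}.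
elim: path T1 T01 edges => //= T path IH T1 T01 /andP[/asboolP[tri1 tri flip] edges].
apply: (IH T) => //; case: flip => flip.
  by apply/(flip_keeps_frozen tri1 tri flip).
by apply/(flip_keeps_frozen tri tri1 flip).
Qed.

End Invariance.
End Frozen.

End Geometry.

(** * Computation of the minors and tests on their signs *)

Section Morph.
Variables (K K' : comNzRingType) (phi : {rmorphism K -> K'}).

Lemma wedge_map w (g : seq bool -> K) bs :
  wedge (map phi w) (phi \o g) bs = phi (wedge w g bs).
Proof.
elim: w g bs => [|a w IH] g [|b bs] /=; rewrite ?rmorph0 //.
case: b; last exact: (IH (fun x => g (false :: x))).
by rewrite rmorphB rmorphM (IH (fun x => g (true :: x))).
Qed.

Lemma minors_map rows bs :
  minors (map (map phi) rows) bs = phi (minors rows bs).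
Proof.
elim: rows bs => [|w rows IH] bs /=; first by rewrite /unit_form rmorph_nat.
by rewrite -(wedge_map w); apply: eq_wedge => x _; apply: IH.
Qed.

Lemma eq_cofactors (g h : seq bool -> K) bs :
  (forall x, size x = size bs -> g x = h x) -> cofactors g bs = cofactors h bs.
Proof.
elim: bs g h => [|b bs IH] g h gh //=.
case: b gh => gh; [rewrite gh //; congr (_ :: map _ _) | congr (_ :: _)];
  by apply: IH => x sx; apply: gh; rewrite /= sx.
Qed.

Lemma cofactors_map (g : seq bool -> K) bs :
  cofactors (phi \o g) bs = map phi (cofactors g bs).
Proof.
elim: bs g => [|b bs IH] g //=.
case: b => /=; last by rewrite rmorph0; congr (_ :: _); exact: (IH (fun x => g (false :: x))).
congr (_ :: _); rewrite -map_comp (IH (fun x => g (true :: x))) -map_comp.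
by apply: eq_map => x /=; rewrite rmorphN.
Qed.
End Morph.

(** A function on bit strings is stored as a binary tree that branches on the
    first bit. [Nil] stands for a subtree of zeros, so that the elements of low
    degree of the exterior algebra are small. *)
Inductive tree (A : Type) := Nil | Leaf of A | Node of tree A & tree A.
Arguments Nil {A}.
Arguments Leaf {A}.
Arguments Node {A}.

Definition left A (f : tree A) := if f is Node x _ then x else Nil.
Definition right A (f : tree A) := if f is Node _ y then y else Nil.
Definition node A (x y : tree A) :=
  match x, y with Nil, Nil => Nil | _, _ => Node x y end.

Notation form := (tree Z).

Fixpoint coef (f : form) (bs : seq bool) : Z :=
  if bs is b :: bs' then coef (if b then right f else left f) bs'
  else if f is Leaf z then z else Z0.

(** [a] times [f] minus [g]. *)
Fixpoint scale_sub n (a : Z) (f g : form) : form :=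
  match f, g with
  | Nil, Nil => Nil
  | _, _ =>
    if n is n'.+1 then
      node (scale_sub n' a (left f) (left g)) (scale_sub n' a (right f) (right g))
    else Leaf (Z.sub (Z.mul a (coef f [::])) (coef g [::]))
  end.

Fixpoint wedge_form n (w : seq Z) (f : form) : form :=
  match n, w, f with
  | n'.+1, a :: w', Node x y =>
      node (wedge_form n' w' x) (scale_sub n' a x (wedge_form n' w' y))
  | _, _, _ => Nil
  end.

Fixpoint unit_tree n : form := if n is n'.+1 then Node (unit_tree n') Nil else Leaf (Zpos xH).

Definition minors_form n (rows : seq (seq Z)) : form :=
  foldr (wedge_form n) (unit_tree n) rows.

Fixpoint cofactors_form (f : form) (bs : seq bool) : seq Z :=
  if bs is b :: bs' then
    if b then coef (left f) bs' :: map Z.opp (cofactors_form (right f) bs')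
    else Z0 :: cofactors_form (left f) bs'
  else [::].

Lemma coef_nil bs : coef Nil bs = 0.
Proof. by elim: bs => // -[]. Qed.

Lemma coef_node (x y : form) b bs :
  coef (node x y) (b :: bs) = coef (if b then y else x) bs.
Proof. by case: x y => [||??] [||??]; case: b => //=; rewrite !coef_nil. Qed.

Lemma coef_scale_sub n a f g bs : size bs = n ->
  coef (scale_sub n a f g) bs = a * coef f bs - coef g bs.
Proof.
elim: n f g bs => [|n IH] f g [|b bs] //.
  by case: f g => [|?|??] [|?|??] //=; rewrite /= mulr0 subr0.
move=> [sb].
have E : coef (node (scale_sub n a (left f) (left g)) (scale_sub n a (right f) (right g)))
    (b :: bs) = a * coef f (b :: bs) - coef g (b :: bs).
  by rewrite coef_node; case: b; rewrite IH.
case: f g E => [|?|??] [|?|??] //= _.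
by case: b; rewrite !coef_nil mulr0 subr0.
Qed.

Lemma coef_wedge n w f bs : size w = n -> size bs = n ->
  coef (wedge_form n w f) bs = wedge w (coef f) bs.
Proof.
elim: n w f bs => [|n IH] [|a w] // f [|b bs] //; move=> [sw] [sb].
have E : wedge (a :: w) (coef f) (b :: bs)
  = if b then a * coef (left f) bs - wedge w (coef (right f)) bs
    else wedge w (coef (left f)) bs by [].
rewrite E; case: f {E} => [|z|x y]; rewrite /= -?/(coef _ _).
- rewrite (@eq_wedge _ _ _ (fun=> 0)) => [|t _]; last by case: b; rewrite coef_nil.
  by case: b; rewrite !coef_nil wedge0 ?mulr0 ?subr0.
- rewrite (@eq_wedge _ _ _ (fun=> 0)) => [|t _]; last by case: b; rewrite coef_nil.
  by case: b; rewrite !coef_nil wedge0 ?mulr0 ?subr0.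
have /= -> := coef_node (wedge_form n w x) (scale_sub n a x (wedge_form n w y)) b bs.
by case: b; rewrite ?coef_scale_sub // IH.
Qed.

Lemma coef_unit_tree n bs : size bs = n -> coef (unit_tree n) bs = unit_form _ bs.
Proof.
elim: n bs => [|n IH] [|b bs] //= [sb].
by case: b; rewrite ?coef_nil //= IH.
Qed.

Lemma coef_minors n rows bs : all (fun w => size w == n) rows -> size bs = n ->
  coef (minors_form n rows) bs = minors rows bs.
Proof.
move=> rowsP; elim: rows bs rowsP => [|w rows IH] bs /=.
  by move=> _; apply: coef_unit_tree.
move=> /andP[/eqP sw rowsP] sb; rewrite coef_wedge //.
by apply: eq_wedge => x sx; apply: IH => //; rewrite sx.
Qed.

Lemma cofactors_formE f bs : cofactors_form f bs = cofactors (coef f) bs.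
Proof. by elim: bs f => [|[] bs IH] f //=; rewrite IH. Qed.

Fixpoint subsets n k : seq (seq bool) :=
  if n is n'.+1 then
    map (cons false) (subsets n' k) ++
    (if k is k'.+1 then map (cons true) (subsets n' k') else [::])
  else if k is 0 then [:: [::]] else [::].

Lemma mem_subsets n k bs : size bs = n -> count id bs = k -> bs \in subsets n k.
Proof.
elim: n k bs => [|n IH] k [|b bs] //=; first by move=> _ <-.
move=> [sb] <-; rewrite mem_cat; case: b => /=.
  by rewrite add1n; apply/orP; right; rewrite map_f // IH.
by rewrite add0n; apply/orP; left; rewrite map_f // IH.
Qed.

(** Sets of bit strings, stored in the same way. *)
Notation family := (tree unit).

Fixpoint fmem (f : family) (bs : seq bool) : bool :=
  if bs is b :: bs' then fmem (if b then right f else left f) bs'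
  else if f is Leaf _ then true else false.

Fixpoint fadd (bs : seq bool) (f : family) : family :=
  if bs is b :: bs' then
    if b then Node (left f) (fadd bs' (right f)) else Node (fadd bs' (left f)) (right f)
  else Leaf tt.

Fixpoint funion n (f g : family) : family :=
  match f, g with
  | Nil, _ => g
  | _, Nil => f
  | _, _ => if n is n'.+1 then
              Node (funion n' (left f) (left g)) (funion n' (right f) (right g))
            else if f is Leaf _ then f else g
  end.

(** All subsets of the members: the second subtree, of the members that contain
    the first element, is merged into the first one. *)
Fixpoint faces n (f : family) : family :=
  match n, f with
  | n'.+1, Node x y => let y' := faces n' y in Node (funion n' (faces n' x) y') y'
  | _, _ => f
  end.

Definition family_of (l : seq (seq bool)) : family := foldr fadd Nil l.

Lemma fmem_nil bs : fmem Nil bs = false.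
Proof. by elim: bs => // -[]. Qed.

Lemma fmem_add bs cs f : size cs = size bs ->
  fmem (fadd bs f) cs = (cs == bs) || fmem f cs.
Proof.
elim: bs cs f => [|b bs IH] [|c cs] f //= [sc].
by rewrite eqseq_cons; case: b; case: c => //=; rewrite IH.
Qed.

Lemma fmem_family_of n l bs : all (fun x => size x == n) l -> size bs = n ->
  fmem (family_of l) bs = (bs \in l).
Proof.
move=> + sb; elim: l => [|c l IH] /=; first by rewrite fmem_nil.
by move=> /andP[/eqP sc /IH {}IH]; rewrite fmem_add ?sc // IH inE.
Qed.

Lemma fmem_union n f g bs : size bs = n ->
  fmem (funion n f g) bs = fmem f bs || fmem g bs.
Proof.
elim: n f g bs => [|n IH] f g [|b bs] //.
  by case: f g => [|[]|??] [|[]|??].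
move=> [sb].
have E : fmem (Node (funion n (left f) (left g)) (funion n (right f) (right g)))
    (b :: bs) = fmem f (b :: bs) || fmem g (b :: bs).
  by rewrite /=; case: b; rewrite IH.
case: f E => [|u|x y] E; first by rewrite fmem_nil.
  by case: g E => [|v|z t] E //; rewrite [X in _ || X]fmem_nil orbF.
by case: g E => [|v|z t] E //; rewrite [X in _ || X]fmem_nil orbF.
Qed.

Lemma fmem_faces n f bs cs : size bs = n -> size cs = n ->
  (forall i, nth false bs i -> nth false cs i) -> fmem f cs -> fmem (faces n f) bs.
Proof.
elim: n f bs cs => [|n IH] f [|b bs] [|c cs] //.
move=> [sb] [sc] sub.
have subt i : nth false bs i -> nth false cs i by apply: (sub i.+1).
case: f => [|?|x y]; try by rewrite /= if_same fmem_nil.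
have := sub 0%N; case: b {sub} => /= [/(_ isT) -> fcs|_ fcs].
  by apply: IH subt fcs.
rewrite fmem_union //; case: c fcs => fcs; apply/orP.
  by right; apply: IH subt fcs.
by left; apply: IH subt fcs.
Qed.
Section Checks.
Variables n k : nat.
Implicit Types (F : form) (f : family) (l : seq (seq bool)).

Definition positive (z : Z) := if z is Zpos _ then true else false.
Definition negative (z : Z) := if z is Zneg _ then true else false.
Definition same_sign x y := (positive x && positive y) || (negative x && negative y).

Definition check_generic F := all (fun bs => coef F bs != Z0) (subsets n k).

(** Several triangulations are tested at once because the circuits are the
    costly part. *)
Definition check_crossing F (fs : seq family) :=
  all (fun bs => let c := cofactors_form F bs in
     let pos := map positive c in let neg := map negative c in
     all (fun f => ~~ (fmem f pos && fmem f neg)) fs) (subsets n k.+1).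

Definition swap (s : seq bool) (c q : nat) := set_nth false (set_nth false s c false) q true.

(** The bit of [c] tells if [q] and [c] are on opposite sides of the facet
    [s :\ c]: this holds when they have the same sign in the circuit on [s] and
    [q]. *)
Definition opposite_sides F (s : seq bool) (q : nat) : seq bool :=
  if nth false s q then nseq n false else
  let l := cofactors_form F (set_nth false s q true) in
  let lq := nth Z0 l q in [seq same_sign z lq | z <- l].

Definition opposite_rows F s := [seq opposite_sides F s q | q <- iota 0 n].

Definition check_adjacent F f l :=
  all (fun s =>
    let opp := opposite_rows F s in
    all (fun c => nth false s c ==>
       (all (fun q => ~~ nth false (nth [::] opp q) c) (iota 0 n)
       || has (fun q => nth false (nth [::] opp q) c && fmem f (swap s c q)) (iota 0 n)))
     (iota 0 n)) l.

Definition check_frozen F f l :=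
  all (fun s =>
    let opp := opposite_rows F s in
    all (fun q => nth false s q ||
      has (fun c => [&& nth false s c, nth false (nth [::] opp q) c &
        has (fun c' => [&& c' != q, nth false (nth [::] opp c') c & fmem f (swap s c c')])
         (iota 0 n)])
      (iota 0 n))
    (iota 0 n)) l.

Definition check_sizes l := all (fun s => (size s == n) && (count id s == k)) l.
End Checks.

(** The row of ones comes first, that is, it is multiplied last: in the highest
    degree, where there are most coefficients, only sums are computed. *)
Definition integer_minors n rows := minors_form n (nseq n (Zpos xH) :: rows).

Section Soundness.
Variables (R : realType) (d n : nat) (rows : seq (seq Z)).

Definition Z_to_real : {rmorphism Z -> R} := intr \o int_of_Z.

Definition integer_points (i : 'I_n) : 'rV[R]_d :=
  \row_k Z_to_real (nth Z0 (nth [::] rows k) i).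

Hypothesis size_rows : size rows = d.
Hypothesis size_row : all (fun w => size w == n) rows.

Local Notation p := integer_points.
Local Notation zrows := (nseq n (Zpos xH) :: rows).
Local Notation F := (integer_minors n rows).

Lemma Z_to_real_gt0 z : (0 < Z_to_real z) = positive z.
Proof.
rewrite /= ltr0z; case: z => [|z|z] //=.
by rewrite /Order.lt /=; have := Pos2Nat.is_pos z; lia.
Qed.

Lemma Z_to_real_lt0 z : (Z_to_real z < 0) = negative z.
Proof.
rewrite /= ltrz0; case: z => [|z|z] //=.
Qed.

Lemma Z_to_real_eq0 z : (Z_to_real z == 0) = (z == Z0).
Proof.
have := Z_to_real_gt0 z; have := Z_to_real_lt0 z.
by case: z => [|z|z] /=; rewrite ?rmorph0 ?eqxx //; case: ltrgt0P.
Qed.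

Lemma homogeneous_integer_rows : homogeneous_rows p = map (map Z_to_real) zrows.
Proof.
have phi1 : Z_to_real (Zpos xH) = 1 by exact: (rmorph1 Z_to_real).
rewrite /homogeneous_rows map_cons map_nseq phi1; congr (_ :: _).
apply: (@eq_from_nth _ [::]) => [|k]; rewrite size_map size_enum_ord.
  by rewrite size_map size_rows.
move=> kd.
rewrite (nth_map (Ordinal kd)) ?size_enum_ord // (nth_map [::]) ?size_rows //.
have /allP/(_ (nth [::] rows k)) := size_row; rewrite mem_nth ?size_rows // => /(_ isT)/eqP sr.
apply: (@eq_from_nth _ 0) => [|i]; rewrite size_map size_enum_ord.
  by rewrite size_map sr.
move=> ilt.
rewrite (nth_map (Ordinal ilt)) ?size_enum_ord // (nth_map Z0) ?sr //.
by rewrite mxE /= !nth_enum_ord.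
Qed.

Lemma size_zrows : all (fun w => size w == n) zrows.
Proof. by rewrite /= size_nseq eqxx. Qed.

Lemma integer_chirotope S : chirotope p S = Z_to_real (coef F (bits S)).
Proof.
rewrite /chirotope homogeneous_integer_rows minors_map coef_minors ?size_bits //.
exact: size_zrows.
Qed.

Lemma integer_circuit C i :
  circuit_dep p C i = Z_to_real (nth Z0 (cofactors_form F (bits C)) i).
Proof.
rewrite /circuit_dep homogeneous_integer_rows cofactors_formE.
rewrite (@eq_cofactors _ _ (Z_to_real \o coef F)) => [|x sx]; last first.
  rewrite minors_map /= coef_minors //; first exact: size_zrows.
  by rewrite sx size_bits.
rewrite cofactors_map; case: (ltnP i (size (bits C))) => ilt.
  by rewrite (nth_map 0) ?size_cofactors.
by rewrite !nth_default ?size_map ?size_cofactors // rmorph0.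
Qed.

Definition cells (l : seq (seq bool)) : {set {set 'I_n}} :=
  [set s | bits s \in l].

Lemma mem_cells l s : (s \in cells l) = (bits s \in l).
Proof. by rewrite inE. Qed.

Lemma count_bits (S : {set 'I_n}) : count id (bits S) = #|S|.
Proof. by rewrite count_map -size_filter cardE /enum_mem filter_predT -enumT. Qed.

Lemma bits_of_seq bs : size bs = n -> bits [set i : 'I_n | nth false bs i] = bs.
Proof.
move=> sb; apply: (@eq_from_nth _ false) => [|i]; rewrite size_bits ?sb // => ilt.
by rewrite -[i]/(val (Ordinal ilt)) nth_map_enum inE.
Qed.

Lemma swap_bits (s : {set 'I_n}) (c q : 'I_n) : swap (bits s) c q = bits (q |: (s :\ c)).
Proof. by rewrite /swap !set_nth_bits. Qed.

Lemma cells_subset k l l' : check_sizes n k l ->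
  (cells l \subset cells l') = all (fun s => s \in l') l.
Proof.
move=> sizes; apply/subsetP/allP => [sub s sl|sub s]; last first.
  by rewrite !mem_cells; apply: sub.
have /andP[/eqP sn _] := allP sizes s sl.
by have := sub [set i : 'I_n | nth false s i]; rewrite !mem_cells bits_of_seq //; apply.
Qed.

Hypothesis generic : check_generic n d.+1 F.

Lemma generic_integer_points (S : {set 'I_n}) : #|S| = d.+1 -> chirotope p S != 0.
Proof.
move=> cS; rewrite integer_chirotope Z_to_real_eq0.
by apply: (allP generic); apply: mem_subsets; rewrite ?size_bits // count_bits.
Qed.

Hypothesis ltdn : (d < n)%N.
Let gen := generic_integer_points.

Lemma opposite_sidesP (s : {set 'I_n}) (q c : 'I_n) : #|s| = d.+1 -> c \in s ->
  nth false (nth [::] (opposite_rows n F (bits s)) q) c =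
  (bary p s (p q) c < 0).
Proof.
move=> cs cins; rewrite (nth_map 0%N) ?size_iota // nth_iota // add0n.
rewrite /opposite_sides nth_map_enum; case: ifPn => qs.
  by rewrite nth_nseq ltn_ord bary_vertex // ltNge ler0n.
have cq : c != q by apply: contraNneq qs => <-.
have cC : #|q |: s| = d.+2 by rewrite cardsU1 qs cs.
have lq : circuit_dep p (q |: s) q != 0.
  by rewrite (circuit_dep_neq0 gen) // !inE eqxx.
rewrite (@bary_of_dependence _ _ _ _ gen ltdn s q (circuit_dep p (q |: s))) //; first last.
- by move=> j; apply: circuit_dep_out.
- exact: circuit_dependence.
rewrite set_nth_bits (nth_map Z0); last first.
  by rewrite cofactors_formE size_cofactors size_bits.
have lc : circuit_dep p (q |: s) c != 0.
  by rewrite (circuit_dep_neq0 gen) // !inE cins orbT.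
rewrite /same_sign -!Z_to_real_gt0 -!Z_to_real_lt0 -!integer_circuit.
rewrite oppr_lt0; set x := circuit_dep _ _ c in lc *; set y := circuit_dep _ _ q in lq *.
case: (ltrgt0P y) lq => // y0 _; first by rewrite pmulr_lgt0 ?invr_gt0 // !andbT andbF orbF.
by rewrite nmulr_lgt0 ?invr_lt0 // andbF andbT.
Qed.

Section Cells.
Variable l : seq (seq bool).
Hypothesis sizes : check_sizes n d.+1 l.

Lemma card_cells s : s \in cells l -> #|s| = d.+1.
Proof. by rewrite inE => /(allP sizes)/andP[_ /eqP]; rewrite count_bits. Qed.

Lemma cells_family s : fmem (family_of l) (bits s) = (s \in cells l).
Proof.
rewrite inE (@fmem_family_of n) ?size_bits //.
by apply: sub_all sizes => x /andP[].
Qed.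

Lemma cells_no_crossing fs k : check_crossing n d.+1 F fs -> (k < size fs)%N ->
  nth Nil fs k = faces n (family_of l) ->
  forall s s', s \in cells l -> s' \in cells l -> ~ crossing p s s'.
Proof.
move=> /allP check kfs fsk s s' sl s'l [C [cC Cpos Cneg]].
have mC : bits C \in subsets n d.+2.
  by rewrite mem_subsets ?size_bits // count_bits.
have /(all_nthP Nil)/(_ k kfs) := check _ mC; rewrite fsk /= => /negP; apply.
have in_faces (D t : {set 'I_n}) (P : Z -> bool) : t \in cells l -> D \subset t ->
    (forall i : 'I_n, (i \in D) = P (nth Z0 (cofactors_form F (bits C)) i)) ->
    fmem (faces n (family_of l)) (map P (cofactors_form F (bits C))).
  move=> tl /subsetP Dt DP.
  have sc : size (cofactors_form F (bits C)) = n.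
    by rewrite cofactors_formE size_cofactors size_bits.
  apply: (@fmem_faces n _ _ (bits t)); rewrite ?size_bits // ?size_map //; last first.
    by rewrite cells_family.
  move=> i; case: (ltnP i n) => [ilt|?]; last by rewrite nth_default // size_map sc.
  rewrite (nth_map Z0) ?sc // -[i]/(val (Ordinal ilt)) -DP => /Dt.
  by rewrite nth_map_enum.
by apply/andP; split; [apply: (in_faces _ s) Cpos _ | apply: (in_faces _ s') Cneg _] => // i;
  rewrite inE integer_circuit ?Z_to_real_gt0 ?Z_to_real_lt0.
Qed.

Lemma cells_adjacent : check_adjacent n F (family_of l) l ->
  forall s c, s \in cells l -> c \in s ->
  (forall q, 0 <= bary p s (p q) c) \/
  exists q, [/\ q \notin s, q |: (s :\ c) \in cells l & bary p s (p q) c < 0].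
Proof.
move=> adj s c sl cins; have cs := card_cells sl; have := sl; rewrite inE => ms.
have := allP adj _ ms => /= /allP/(_ (val c)).
rewrite mem_iota ltn_ord nth_map_enum cins /= => /(_ isT)/orP[/allP no|/hasP[q]].
  left=> q; have := no (val q); rewrite mem_iota ltn_ord /= => /(_ isT).
  by rewrite opposite_sidesP // -leNgt.
rewrite mem_iota add0n /= => qn; rewrite -[q]/(val (Ordinal qn)) => /andP[].
rewrite opposite_sidesP // swap_bits cells_family => opp mem; right.
exists (Ordinal qn); split=> //.
by apply: contraTN opp => qs; rewrite bary_vertex // -leNgt ler0n.
Qed.

Lemma cells_frozen : check_frozen n F (family_of l) l -> frozen p (cells l).
Proof.
move=> fro s q sl qs; have cs := card_cells sl; have := sl; rewrite inE => ms.
have := allP fro _ ms => /= /allP/(_ (val q)).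
rewrite mem_iota ltn_ord nth_map_enum (negPf qs) /= => /(_ isT)/hasP[c].
rewrite mem_iota add0n /= => cn; rewrite -[c]/(val (Ordinal cn)) nth_map_enum.
move=> /and3P[cins]; rewrite opposite_sidesP // => opp /hasP[c'].
rewrite mem_iota add0n /= => c'n; rewrite -[c']/(val (Ordinal c'n)) -[c]/(val (Ordinal cn)).
rewrite opposite_sidesP // swap_bits cells_family => /and3P[c'q opp' mem].
exists (Ordinal cn), (Ordinal c'n); split=> //.
by apply: contraTN opp' => c's; rewrite bary_vertex // -leNgt ler0n.
Qed.

Lemma cells_triangulation fs k : l != [::] ->
  check_crossing n d.+1 F fs -> (k < size fs)%N ->
  nth Nil fs k = faces n (family_of l) ->
  check_adjacent n F (family_of l) l -> is_triangulation p (cells l).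
Proof.
move=> l0 cross kfs fsk adj; apply: triangulation_criterion => //.
- have hl : head [::] l \in l by case: l l0 => //= s l' _; rewrite mem_head.
  have /andP[/eqP sh _] := allP sizes _ hl.
  by apply/set0Pn; exists [set i : 'I_n | nth false (head [::] l) i]; rewrite inE bits_of_seq.
- exact: card_cells.
- exact: cells_adjacent.
- exact: cells_no_crossing cross kfs fsk.
Qed.

End Cells.

End Soundness.
(** * The point configuration and its two triangulations *)

(** One row per coordinate. Point 0 is the origin; the points [1 + 2 v] and
    [2 + 2 v] are close to [(v, x_v)] and [(v, - x_v)] up to scaling, the vertices
    being numbered a_0, .., a_3, b_0, .., b_3. *)
Section Coordinates.
Local Open Scope Z_scope.
Definition coordinates : seq (seq Z) := [::
  [:: 0; 86; 68; - 2; 0; - 87; - 68; 1; 0; 1; - 1; 0; 1; 2; - 3; - 2; 0];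
  [:: 0; 1; 0; 70; 83; 1; 0; - 80; - 73; 0; 0; 3; - 3; 1; 0; - 4; 3];
  [:: 0; - 3; 4; 0; - 1; - 2; 2; 1; 0; 77; 72; - 1; 1; - 86; - 60; 1; 1];
  [:: 0; 2; - 2; - 2; 3; - 2; 3; - 2; - 2; 3; - 3; 69; 80; - 3; 2; - 78; - 72];
  [:: 0; 25; - 24; 77; - 72; - 45; 45; - 47; 43; 64; - 65; 63; - 61; - 57; 59; 57; - 59];
  [:: 0; 2; - 4; 57; - 62; 27; - 24; 48; - 41; 25; - 21; 42; - 38; 42; - 41; 58; - 63]].
End Coordinates.

(** Four rhombi in each of the 16 octagons. *)
Definition core_cells : seq (seq nat) := [::
  [:: 0; 1; 2; 3; 4; 10; 12]; [:: 0; 1; 2; 3; 4; 10; 15]; [:: 0; 1; 2; 3; 4; 12; 14];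
  [:: 0; 1; 2; 3; 4; 14; 15]; [:: 0; 1; 2; 3; 10; 11; 12]; [:: 0; 1; 2; 3; 11; 12; 14];
  [:: 0; 1; 2; 4; 10; 15; 16]; [:: 0; 1; 2; 4; 14; 15; 16]; [:: 0; 1; 2; 7; 8; 10; 11];
  [:: 0; 1; 2; 7; 8; 10; 16]; [:: 0; 1; 2; 7; 8; 11; 14]; [:: 0; 1; 2; 7; 8; 14; 16];
  [:: 0; 1; 2; 7; 10; 15; 16]; [:: 0; 1; 2; 7; 14; 15; 16]; [:: 0; 1; 2; 8; 10; 11; 12];
  [:: 0; 1; 2; 8; 11; 12; 14]; [:: 0; 1; 3; 4; 9; 10; 12]; [:: 0; 1; 3; 4; 9; 10; 15];
  [:: 0; 1; 3; 9; 10; 11; 12]; [:: 0; 1; 4; 9; 10; 15; 16]; [:: 0; 1; 7; 8; 9; 10; 11];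
  [:: 0; 1; 7; 8; 9; 10; 16]; [:: 0; 1; 7; 9; 10; 15; 16]; [:: 0; 1; 8; 9; 10; 11; 12];
  [:: 0; 2; 3; 4; 12; 13; 14]; [:: 0; 2; 3; 4; 13; 14; 15]; [:: 0; 2; 3; 11; 12; 13; 14];
  [:: 0; 2; 4; 13; 14; 15; 16]; [:: 0; 2; 7; 8; 11; 13; 14]; [:: 0; 2; 7; 8; 13; 14; 16];
  [:: 0; 2; 7; 13; 14; 15; 16]; [:: 0; 2; 8; 11; 12; 13; 14]; [:: 0; 3; 4; 5; 6; 9; 12];
  [:: 0; 3; 4; 5; 6; 9; 15]; [:: 0; 3; 4; 5; 6; 12; 13]; [:: 0; 3; 4; 5; 6; 13; 15];
  [:: 0; 3; 4; 5; 9; 10; 12]; [:: 0; 3; 4; 5; 9; 10; 15]; [:: 0; 3; 4; 6; 12; 13; 14];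
  [:: 0; 3; 4; 6; 13; 14; 15]; [:: 0; 3; 5; 6; 9; 11; 12]; [:: 0; 3; 5; 6; 11; 12; 13];
  [:: 0; 3; 5; 9; 10; 11; 12]; [:: 0; 3; 6; 11; 12; 13; 14]; [:: 0; 4; 5; 6; 9; 15; 16];
  [:: 0; 4; 5; 6; 13; 15; 16]; [:: 0; 4; 5; 9; 10; 15; 16]; [:: 0; 4; 6; 13; 14; 15; 16];
  [:: 0; 5; 6; 7; 8; 9; 11]; [:: 0; 5; 6; 7; 8; 9; 16]; [:: 0; 5; 6; 7; 8; 11; 13];
  [:: 0; 5; 6; 7; 8; 13; 16]; [:: 0; 5; 6; 7; 9; 15; 16]; [:: 0; 5; 6; 7; 13; 15; 16];
  [:: 0; 5; 6; 8; 9; 11; 12]; [:: 0; 5; 6; 8; 11; 12; 13]; [:: 0; 5; 7; 8; 9; 10; 11];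
  [:: 0; 5; 7; 8; 9; 10; 16]; [:: 0; 5; 7; 9; 10; 15; 16]; [:: 0; 5; 8; 9; 10; 11; 12];
  [:: 0; 6; 7; 8; 11; 13; 14]; [:: 0; 6; 7; 8; 13; 14; 16]; [:: 0; 6; 7; 13; 14; 15; 16];
  [:: 0; 6; 8; 11; 12; 13; 14]].
(** The other two rhombi of each octagon. *)
Definition corner_cells : seq (seq nat) := [::
  [:: 0; 1; 2; 3; 9; 10; 11]; [:: 0; 1; 2; 3; 9; 10; 15]; [:: 0; 1; 2; 3; 11; 13; 14];
  [:: 0; 1; 2; 3; 13; 14; 15]; [:: 0; 1; 2; 7; 9; 10; 11]; [:: 0; 1; 2; 7; 9; 10; 15];
  [:: 0; 1; 2; 7; 11; 13; 14]; [:: 0; 1; 2; 7; 13; 14; 15]; [:: 0; 1; 3; 4; 9; 11; 12];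
  [:: 0; 1; 3; 4; 9; 15; 16]; [:: 0; 1; 3; 4; 11; 12; 14]; [:: 0; 1; 3; 4; 14; 15; 16];
  [:: 0; 1; 7; 8; 9; 15; 16]; [:: 0; 1; 7; 8; 14; 15; 16]; [:: 0; 2; 7; 8; 10; 11; 12];
  [:: 0; 2; 7; 8; 11; 12; 13]; [:: 0; 3; 4; 6; 9; 11; 12]; [:: 0; 3; 4; 6; 9; 15; 16];
  [:: 0; 3; 4; 6; 11; 12; 14]; [:: 0; 3; 4; 6; 14; 15; 16]; [:: 0; 4; 5; 6; 9; 10; 12];
  [:: 0; 4; 5; 6; 9; 10; 16]; [:: 0; 4; 5; 6; 12; 13; 14]; [:: 0; 4; 5; 6; 13; 14; 16];
  [:: 0; 5; 6; 8; 9; 10; 12]; [:: 0; 5; 6; 8; 9; 10; 16]; [:: 0; 5; 6; 8; 12; 13; 14];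
  [:: 0; 5; 6; 8; 13; 14; 16]; [:: 0; 5; 7; 8; 10; 11; 12]; [:: 0; 5; 7; 8; 11; 12; 13];
  [:: 0; 6; 7; 8; 9; 15; 16]; [:: 0; 6; 7; 8; 14; 15; 16]].
(** The gap between the octagon tilings and the boundary of the convex hull. Each
    cell comes from a hexagon and one more point: the tilings are changed by
    hexagon flips into those given by the boundary of the convex hull. *)
Definition lens_cells : seq (seq nat) := [::
  [:: 1; 2; 3; 4; 12; 13; 14]; [:: 1; 2; 3; 4; 13; 14; 15]; [:: 1; 2; 3; 11; 12; 13; 14];
  [:: 1; 2; 4; 13; 14; 15; 16]; [:: 1; 2; 7; 8; 10; 11; 12]; [:: 1; 2; 7; 8; 11; 12; 13];
  [:: 1; 2; 7; 8; 11; 13; 14]; [:: 1; 2; 7; 8; 13; 14; 16]; [:: 1; 2; 7; 13; 14; 15; 16];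
  [:: 1; 2; 8; 11; 12; 13; 14]; [:: 1; 3; 4; 11; 12; 13; 14]; [:: 1; 7; 8; 9; 10; 11; 12];
  [:: 1; 7; 8; 9; 10; 15; 16]; [:: 1; 7; 8; 13; 14; 15; 16]; [:: 3; 4; 5; 6; 9; 11; 12];
  [:: 3; 4; 5; 6; 11; 12; 13]; [:: 3; 4; 5; 6; 11; 13; 14]; [:: 3; 4; 5; 6; 13; 14; 15];
  [:: 3; 4; 6; 11; 12; 13; 14]; [:: 4; 5; 6; 11; 12; 13; 14]; [:: 4; 5; 6; 13; 14; 15; 16];
  [:: 5; 6; 7; 8; 9; 15; 16]; [:: 5; 6; 7; 8; 13; 15; 16]; [:: 5; 6; 8; 11; 12; 13; 14];
  [:: 5; 6; 8; 13; 14; 15; 16]; [:: 5; 7; 8; 9; 10; 11; 12]; [:: 5; 7; 8; 9; 10; 15; 16];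
  [:: 6; 7; 8; 13; 14; 15; 16]].
(** Cones over the facets of the convex hull that are not above a facet of the
    cross-polytope. *)
Definition outer_cells : seq (seq nat) := [::
  [:: 0; 1; 2; 3; 7; 9; 11]; [:: 0; 1; 2; 3; 7; 9; 15]; [:: 0; 1; 2; 3; 7; 11; 13];
  [:: 0; 1; 2; 3; 7; 13; 15]; [:: 0; 1; 2; 4; 10; 12; 16]; [:: 0; 1; 2; 4; 12; 14; 16];
  [:: 0; 1; 2; 8; 10; 12; 16]; [:: 0; 1; 2; 8; 12; 14; 16]; [:: 0; 1; 3; 4; 9; 11; 14];
  [:: 0; 1; 3; 4; 9; 14; 16]; [:: 0; 1; 3; 7; 9; 11; 15]; [:: 0; 1; 3; 7; 11; 13; 15];
  [:: 0; 1; 3; 9; 11; 14; 15]; [:: 0; 1; 3; 9; 14; 15; 16]; [:: 0; 1; 3; 11; 13; 14; 15];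
  [:: 0; 1; 4; 8; 9; 10; 12]; [:: 0; 1; 4; 8; 9; 10; 16]; [:: 0; 1; 4; 8; 9; 12; 14];
  [:: 0; 1; 4; 8; 9; 14; 16]; [:: 0; 1; 4; 8; 10; 12; 16]; [:: 0; 1; 4; 8; 12; 14; 16];
  [:: 0; 1; 4; 9; 11; 12; 14]; [:: 0; 1; 7; 8; 9; 11; 15]; [:: 0; 1; 7; 8; 11; 14; 15];
  [:: 0; 1; 7; 11; 13; 14; 15]; [:: 0; 1; 8; 9; 11; 12; 14]; [:: 0; 1; 8; 9; 11; 14; 15];
  [:: 0; 1; 8; 9; 14; 15; 16]; [:: 0; 2; 3; 4; 10; 12; 13]; [:: 0; 2; 3; 4; 10; 13; 15];
  [:: 0; 2; 3; 7; 9; 10; 11]; [:: 0; 2; 3; 7; 9; 10; 15]; [:: 0; 2; 3; 7; 10; 11; 13];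
  [:: 0; 2; 3; 7; 10; 13; 15]; [:: 0; 2; 3; 10; 11; 12; 13]; [:: 0; 2; 4; 10; 12; 13; 16];
  [:: 0; 2; 4; 10; 13; 15; 16]; [:: 0; 2; 4; 12; 13; 14; 16]; [:: 0; 2; 7; 8; 10; 12; 16];
  [:: 0; 2; 7; 8; 12; 13; 16]; [:: 0; 2; 7; 10; 11; 12; 13]; [:: 0; 2; 7; 10; 12; 13; 16];
  [:: 0; 2; 7; 10; 13; 15; 16]; [:: 0; 2; 8; 12; 13; 14; 16]; [:: 0; 3; 4; 5; 10; 12; 13];
  [:: 0; 3; 4; 5; 10; 13; 15]; [:: 0; 3; 4; 6; 9; 11; 14]; [:: 0; 3; 4; 6; 9; 14; 16];
  [:: 0; 3; 5; 6; 9; 11; 15]; [:: 0; 3; 5; 6; 11; 13; 15]; [:: 0; 3; 5; 7; 9; 10; 11];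
  [:: 0; 3; 5; 7; 9; 10; 15]; [:: 0; 3; 5; 7; 9; 11; 15]; [:: 0; 3; 5; 7; 10; 11; 13];
  [:: 0; 3; 5; 7; 10; 13; 15]; [:: 0; 3; 5; 7; 11; 13; 15]; [:: 0; 3; 5; 10; 11; 12; 13];
  [:: 0; 3; 6; 9; 11; 14; 15]; [:: 0; 3; 6; 9; 14; 15; 16]; [:: 0; 3; 6; 11; 13; 14; 15];
  [:: 0; 4; 5; 6; 10; 12; 16]; [:: 0; 4; 5; 6; 12; 14; 16]; [:: 0; 4; 5; 10; 12; 13; 16];
  [:: 0; 4; 5; 10; 13; 15; 16]; [:: 0; 4; 5; 12; 13; 14; 16]; [:: 0; 4; 6; 8; 9; 10; 12];
  [:: 0; 4; 6; 8; 9; 10; 16]; [:: 0; 4; 6; 8; 9; 12; 14]; [:: 0; 4; 6; 8; 9; 14; 16];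
  [:: 0; 4; 6; 8; 10; 12; 16]; [:: 0; 4; 6; 8; 12; 14; 16]; [:: 0; 4; 6; 9; 11; 12; 14];
  [:: 0; 5; 6; 7; 9; 11; 15]; [:: 0; 5; 6; 7; 11; 13; 15]; [:: 0; 5; 6; 8; 10; 12; 16];
  [:: 0; 5; 6; 8; 12; 14; 16]; [:: 0; 5; 7; 8; 10; 12; 16]; [:: 0; 5; 7; 8; 12; 13; 16];
  [:: 0; 5; 7; 10; 11; 12; 13]; [:: 0; 5; 7; 10; 12; 13; 16]; [:: 0; 5; 7; 10; 13; 15; 16];
  [:: 0; 5; 8; 12; 13; 14; 16]; [:: 0; 6; 7; 8; 9; 11; 15]; [:: 0; 6; 7; 8; 11; 14; 15];
  [:: 0; 6; 7; 11; 13; 14; 15]; [:: 0; 6; 8; 9; 11; 12; 14]; [:: 0; 6; 8; 9; 11; 14; 15];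
  [:: 0; 6; 8; 9; 14; 15; 16]].
(** Cones over the facets of the convex hull that are above a facet of the
    cross-polytope: another coherent family of octagon tilings. *)
Definition star_cells : seq (seq nat) := [::
  [:: 0; 1; 2; 3; 4; 10; 12]; [:: 0; 1; 2; 3; 4; 10; 15]; [:: 0; 1; 2; 3; 4; 12; 13];
  [:: 0; 1; 2; 3; 4; 13; 15]; [:: 0; 1; 2; 3; 9; 10; 11]; [:: 0; 1; 2; 3; 9; 10; 15];
  [:: 0; 1; 2; 3; 10; 11; 12]; [:: 0; 1; 2; 3; 11; 12; 13]; [:: 0; 1; 2; 4; 10; 15; 16];
  [:: 0; 1; 2; 4; 12; 13; 14]; [:: 0; 1; 2; 4; 13; 14; 16]; [:: 0; 1; 2; 4; 13; 15; 16];
  [:: 0; 1; 2; 7; 8; 10; 12]; [:: 0; 1; 2; 7; 8; 10; 16]; [:: 0; 1; 2; 7; 8; 12; 13];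
  [:: 0; 1; 2; 7; 8; 13; 16]; [:: 0; 1; 2; 7; 9; 10; 11]; [:: 0; 1; 2; 7; 9; 10; 15];
  [:: 0; 1; 2; 7; 10; 11; 12]; [:: 0; 1; 2; 7; 10; 15; 16]; [:: 0; 1; 2; 7; 11; 12; 13];
  [:: 0; 1; 2; 7; 13; 15; 16]; [:: 0; 1; 2; 8; 12; 13; 14]; [:: 0; 1; 2; 8; 13; 14; 16];
  [:: 0; 1; 3; 4; 9; 10; 12]; [:: 0; 1; 3; 4; 9; 10; 15]; [:: 0; 1; 3; 4; 9; 11; 12];
  [:: 0; 1; 3; 4; 9; 15; 16]; [:: 0; 1; 3; 4; 11; 12; 13]; [:: 0; 1; 3; 4; 11; 13; 14];
  [:: 0; 1; 3; 4; 13; 14; 15]; [:: 0; 1; 3; 4; 14; 15; 16]; [:: 0; 1; 3; 9; 10; 11; 12];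
  [:: 0; 1; 4; 9; 10; 15; 16]; [:: 0; 1; 4; 11; 12; 13; 14]; [:: 0; 1; 4; 13; 14; 15; 16];
  [:: 0; 1; 7; 8; 9; 10; 12]; [:: 0; 1; 7; 8; 9; 10; 15]; [:: 0; 1; 7; 8; 9; 11; 12];
  [:: 0; 1; 7; 8; 10; 15; 16]; [:: 0; 1; 7; 8; 11; 12; 13]; [:: 0; 1; 7; 8; 11; 13; 14];
  [:: 0; 1; 7; 8; 13; 14; 15]; [:: 0; 1; 7; 8; 13; 15; 16]; [:: 0; 1; 7; 9; 10; 11; 12];
  [:: 0; 1; 8; 9; 10; 15; 16]; [:: 0; 1; 8; 11; 12; 13; 14]; [:: 0; 1; 8; 13; 14; 15; 16];
  [:: 0; 3; 4; 5; 6; 9; 11]; [:: 0; 3; 4; 5; 6; 9; 15]; [:: 0; 3; 4; 5; 6; 11; 14];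
  [:: 0; 3; 4; 5; 6; 14; 15]; [:: 0; 3; 4; 5; 9; 10; 12]; [:: 0; 3; 4; 5; 9; 10; 15];
  [:: 0; 3; 4; 5; 9; 11; 12]; [:: 0; 3; 4; 5; 11; 12; 13]; [:: 0; 3; 4; 5; 11; 13; 14];
  [:: 0; 3; 4; 5; 13; 14; 15]; [:: 0; 3; 4; 6; 9; 15; 16]; [:: 0; 3; 4; 6; 14; 15; 16];
  [:: 0; 3; 5; 6; 11; 13; 14]; [:: 0; 3; 5; 6; 13; 14; 15]; [:: 0; 3; 5; 9; 10; 11; 12];
  [:: 0; 4; 5; 6; 9; 10; 12]; [:: 0; 4; 5; 6; 9; 10; 16]; [:: 0; 4; 5; 6; 9; 11; 12];
  [:: 0; 4; 5; 6; 9; 15; 16]; [:: 0; 4; 5; 6; 11; 12; 14]; [:: 0; 4; 5; 6; 14; 15; 16];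
  [:: 0; 4; 5; 9; 10; 15; 16]; [:: 0; 4; 5; 11; 12; 13; 14]; [:: 0; 4; 5; 13; 14; 15; 16];
  [:: 0; 5; 6; 7; 8; 9; 11]; [:: 0; 5; 6; 7; 8; 9; 15]; [:: 0; 5; 6; 7; 8; 11; 13];
  [:: 0; 5; 6; 7; 8; 13; 15]; [:: 0; 5; 6; 8; 9; 10; 12]; [:: 0; 5; 6; 8; 9; 10; 16];
  [:: 0; 5; 6; 8; 9; 11; 12]; [:: 0; 5; 6; 8; 9; 15; 16]; [:: 0; 5; 6; 8; 11; 12; 14];
  [:: 0; 5; 6; 8; 11; 13; 14]; [:: 0; 5; 6; 8; 13; 14; 15]; [:: 0; 5; 6; 8; 14; 15; 16];
  [:: 0; 5; 7; 8; 9; 10; 12]; [:: 0; 5; 7; 8; 9; 10; 15]; [:: 0; 5; 7; 8; 9; 11; 12];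
  [:: 0; 5; 7; 8; 10; 15; 16]; [:: 0; 5; 7; 8; 11; 12; 13]; [:: 0; 5; 7; 8; 13; 15; 16];
  [:: 0; 5; 7; 9; 10; 11; 12]; [:: 0; 5; 8; 9; 10; 15; 16]; [:: 0; 5; 8; 11; 12; 13; 14];
  [:: 0; 5; 8; 13; 14; 15; 16]; [:: 0; 6; 7; 8; 11; 13; 14]; [:: 0; 6; 7; 8; 13; 14; 15]].
Definition codes (l : seq (seq nat)) : seq (seq bool) :=
  [seq [seq i \in s | i <- iota 0 17] | s <- l].

Definition core := codes core_cells.
Definition frozen_triangulation :=
  codes (core_cells ++ corner_cells ++ lens_cells ++ outer_cells).
Definition star_triangulation := codes (star_cells ++ outer_cells).

Notation all_minors := (integer_minors 17 coordinates).

Lemma generic_checked : check_generic 17 7 all_minors.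
Proof. by vm_compute. Qed.

Lemma sizes_checked : [&& check_sizes 17 7 core, check_sizes 17 7 frozen_triangulation
  & check_sizes 17 7 star_triangulation].
Proof. by vm_compute. Qed.

Lemma crossing_checked : check_crossing 17 7 all_minors
  [:: faces 17 (family_of frozen_triangulation); faces 17 (family_of star_triangulation)].
Proof. by vm_compute. Qed.

Lemma frozen_adjacent_checked :
  check_adjacent 17 all_minors (family_of frozen_triangulation) frozen_triangulation.
Proof. by vm_compute. Qed.

Lemma star_adjacent_checked :
  check_adjacent 17 all_minors (family_of star_triangulation) star_triangulation.
Proof. by vm_compute. Qed.

Lemma core_checked : check_frozen 17 all_minors (family_of core) core.
Proof. by vm_compute. Qed.

Lemma triangulations_neq0 : (frozen_triangulation != [::]) && (star_triangulation != [::]).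
Proof. by vm_compute. Qed.

Lemma core_cells_checked : all (fun s => s \in frozen_triangulation) core
  && ~~ all (fun s => s \in star_triangulation) core.
Proof. by vm_compute. Qed.

Theorem mainTheorem1 (R : realType) :
  exists p : 'I_17 -> 'rV[R]_6,
    injective p /\ general_position p /\ ~ flip_graph_connected p.
Proof.
pose p := @integer_points R 6 17 coordinates.
have size_rows : size coordinates = 6 by [].
have size_row : all (fun w => size w == 17) coordinates by [].
have gen := @generic_integer_points R 6 17 coordinates size_rows size_row generic_checked.
have lt617 : (6 < 17)%N by [].
have /and3P[core_sizes frozen_sizes star_sizes] := sizes_checked.
exists p; split.
  move=> i j; apply: contra_eq => ij; exact: (points_neq gen lt617).
split; first exact: generic_general_position.
have /andP[frozen_neq0 star_neq0] := triangulations_neq0.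
have tri_frozen : is_triangulation p (cells 17 frozen_triangulation).
  apply: (@cells_triangulation R 6 17 coordinates size_rows size_row
    generic_checked lt617 frozen_triangulation frozen_sizes _ 0 frozen_neq0 crossing_checked).
  - by [].
  - by [].
  exact: frozen_adjacent_checked.
have tri_star : is_triangulation p (cells 17 star_triangulation).
  apply: (@cells_triangulation R 6 17 coordinates size_rows size_row
    generic_checked lt617 star_triangulation star_sizes _ 1 star_neq0 crossing_checked).
  - by [].
  - by [].
  exact: star_adjacent_checked.
have core_frozen := @cells_frozen R 6 17 coordinates size_rows size_row
  generic_checked lt617 core core_sizes core_checked.
have /andP[core_in core_out] := core_cells_checked.
apply: (frozen_disconnected gen lt617 isT core_frozen tri_frozen tri_star).
  by rewrite (cells_subset _ core_sizes).
by rewrite (cells_subset _ core_sizes).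
Qed.
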